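(* Consider a product $\gamma_1\cdots\gamma_p$ of gamma terms, denote by $p_2^*$ the largest number of smart pairs that can be obtained, and by $p_3^*$ the largest number of smart triplets that can be obtained once $p_2^*$ smart pairs are removed. Then, as $d\to\infty$, $$ \mathbb E[\gamma_1\cdots\gamma_p]=O_p\left(d^{-\frac32p-\frac16(3p_3^* )-\frac14(p-2p_2^*-3p_3^* )}\right). $$
   Context: $\Psi=(\psi_{jk})_{j,k=1}^d$ is a Haar-distributed unitary $d\times d$ matrix. A gamma term is a random variable $$\gamma(k,l,m,n)=\sum_{j=1}^d\overline{\psi_{jk}}\psi_{jl}\overline{\psi_{jm}}\psi_{jn}-\frac1d\delta_{kl}\delta_{mn}-\frac1d\delta_{kn}\delta_{lm},$$ with arbitrary $k,l,m,n\in\{1,\dots,d\}$; it is said to be of type $klmn$, repeated letters indicating equal indices (so the type $kkkk$ means all four indices are equal). Note $\overline{\gamma(k,l,m,n)}=\gamma(l,k,n,m)$ is also a gamma term, and $\gamma(k,l,m,n)=\gamma(m,l,k,n)=\gamma(k,n,m,l)$. Expanding the product $\gamma_1\cdots\gamma_p$, each gamma term carries its own summation index $j$. For a choice of $j$-indices one forms the Weingarten graph: black vertices are the distinct $j$'s, white vertices the distinct column indices, each factor $\psi_{jk}$ is an edge directed from $j$ to $k$ and each factor $\overline{\psi_{jk}}$ an edge directed from $k$ to $j$. A circuit covering is a partition of the edges into directed circuits; a $2$-circuit is a circuit formed by one $\psi_{jk}$-edge and one $\overline{\psi_{jk}}$-edge. Given an identification of the $j$-indices (which ones are equal) and a circuit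 covering: - a smart pair is a configuration where a pair of gamma terms with one common index $j$ forms four $2$-circuits; - a smart triplet is a configuration where three gamma terms with one common index $j$ form six $2$-circuits. In counting these $2$-circuits, those formed within a single gamma term and coming from a centered factor are disregarded: a $2$-circuit made of two edges of the same gamma term is not counted if that term is of type $kkmn$ (with $m\ne n$) or $kkmm$ (with $m\neq k$), up to reordering indices; and in a term of type $kkkk$ one does not count coverings in which all four edges of the term are paired among themselves into two $2$-circuits (a single such internal $2$-circuit is allowed). With this convention, smart pairs occur only when pairing a gamma term with its complex conjugate. Different smart pairs/triplets must use disjoint sets of the factors $\gamma_1,\dots,\gamma_p$. The constant in $O_p$ depends only on $p$. *)

(* Defs.v *)
From HB Require Import structures.
From mathcomp Require Import all_boot all_order all_algebra.
From mathcomp Require Import spectral complex.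
From mathcomp Require Import all_classical all_reals all_analysis.

Set Implicit Arguments.
Unset Strict Implicit.
Unset Printing Implicit Defensive.

Import Order.TTheory GRing.Theory Num.Theory numFieldNormedType.Exports.

Local Open Scope classical_set_scope.
Local Open Scope complex_scope.
Local Open Scope ring_scope.

(* The space of complex d x d matrices with its Borel sigma-algebra; the ^o
   selects the topology that R[i] carries as a normed space. *)
Definition borelM (R : realType) (d : nat) :=
  g_sigma_algebraType (@open 'M[R[i]^o]_d).

(* The law of Psi is the Haar probability measure of the compact group U(d):
   it is carried by U(d) and invariant under left and right translations. *)
Definition haar_unitary (R : realType) (d : nat)
    (disp : measure_display) (T : measurableType disp)
    (P : probability T R) (Psi : T -> 'M[R[i]]_d) : Prop :=
  [/\ measurable_fun setT (Psi : T -> borelM R d),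
      (forall w, Psi w \is unitarymx),
      (forall U : 'M[R[i]]_d, U \is unitarymx ->
         forall B : set (borelM R d), measurable B ->
           P [set w | B (U *m Psi w)] = P [set w | B (Psi w)])
    & (forall U : 'M[R[i]]_d, U \is unitarymx ->
         forall B : set (borelM R d), measurable B ->
           P [set w | B (Psi w *m U)] = P [set w | B (Psi w)])].

(* Only used below for bounded measurable X, for which both parts are finite. *)
Definition cexpectation (R : realType)
    (disp : measure_display) (T : measurableType disp)
    (P : probability T R) (X : T -> R[i]) : R[i] :=
  fine 'E_P[fun w => complex.Re (X w)] +i* fine 'E_P[fun w => complex.Im (X w)].

(* The column indices (k, l, m, n) of a gamma term. *)
Definition gidx (d : nat) := ('I_d * 'I_d * 'I_d * 'I_d)%type.

Definition gamma (R : realType) (d : nat) (psi : 'M[R[i]]_d) (t : gidx d)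
    : R[i] :=
  let: (k, l, m, n) := t in
  \sum_(j < d) (psi j k)^* * psi j l * (psi j m)^* * psi j n
  - d%:R^-1 * (k == l)%:R * (m == n)%:R
  - d%:R^-1 * (k == n)%:R * (l == m)%:R.

Local Open Scope nat_scope.

(* The index tuples related to t by the symmetries
   gamma(k,l,m,n) = gamma(m,l,k,n) = gamma(k,n,m,l). *)
Definition reorderings (d : nat) (t : gidx d) : seq (gidx d) :=
  let: (k, l, m, n) := t in
  [:: (k, l, m, n); (m, l, k, n); (k, n, m, l); (m, n, k, l)].

(* m or n is allowed to coincide with k here, as in kkkn and kkmk. *)
Definition type_kkmn (d : nat) (t : gidx d) : bool :=
  has (fun s : gidx d => let: (k, l, m, n) := s in (k == l) && (m != n))
      (reorderings t).

Definition type_kkmm (d : nat) (t : gidx d) : bool :=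
  has (fun s : gidx d => let: (k, l, m, n) := s in
         [&& k == l, m == n & m != k])
      (reorderings t).

Definition type_kkkk (d : nat) (t : gidx d) : bool :=
  let: (k, l, m, n) := t in [&& k == l, l == m & m == n].

(* The edge (i, (c, s)) is a factor of the i-th gamma term: c tells whether it
   is conjugated, s whether it is the second of the two such factors. *)
Definition edge (p : nat) := ('I_p * (bool * bool))%type.

Definition gterm (p : nat) (e : edge p) : 'I_p := e.1.
Definition conjugated (p : nat) (e : edge p) : bool := e.2.1.

Definition column (p d : nat) (g : 'I_p -> gidx d) (e : edge p) : 'I_d :=
  let: (k, l, m, n) := g (gterm e) in
  match e.2 with
  | (true, false) => k
  | (false, false) => l
  | (true, true) => m
  | (false, true) => n
  end.

Section Weingarten.
Variables (p d : nat) (g : 'I_p -> gidx d) (J : {ffun 'I_p -> 'I_d}).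

(* J i is the summation index of the i-th gamma term.  Vertices: inl j is the
   black vertex j and inr k the white vertex k. *)
Definition source (e : edge p) : 'I_d + 'I_d :=
  if conjugated e then inr (column g e) else inl (J (gterm e)).

Definition target (e : edge p) : 'I_d + 'I_d :=
  if conjugated e then inl (J (gterm e)) else inr (column g e).

(* B is the edge set of a closed directed trail. *)
Definition circuit (B : {set edge p}) : bool :=
  has (cycle (fun e f => target e == source f)) (permutations (enum B)).

Definition circuit_covering (C : {set {set edge p}}) : bool :=
  finset.partition C [set: edge p]%SET && [forall B in C, circuit B].

Definition two_circuit (B : {set edge p}) : bool :=
  [exists e, exists f,
    [&& ~~ conjugated e, conjugated f, J (gterm e) == J (gterm f),
        column g e == column g f & B == [set e; f]%SET]].

Variable C : {set {set edge p}}.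

(* The 2-circuits of C all of whose edges belong to gamma terms in S. *)
Definition two_circuits_in (S : {set 'I_p}) : {set {set edge p}} :=
  [set B in C | two_circuit B && [forall e in B, gterm e \in S]]%SET.

(* The internal 2-circuits that the centering of the i-th term removes. *)
Definition disregarded (i : 'I_p) : {set {set edge p}} :=
  [set B in two_circuits_in [set i] |
    [|| type_kkmn (g i), type_kkmm (g i)
      | type_kkkk (g i) && (#|two_circuits_in [set i]%SET| == 2)]]%SET.

Definition counted_two_circuits (S : {set 'I_p}) : {set {set edge p}} :=
  [set B in two_circuits_in S | [forall i, B \notin disregarded i]]%SET.

(* The q terms in S share one index j and form 2q of the 2-circuits. *)
Definition smart (q : nat) (S : {set 'I_p}) : bool :=
  [&& #|S| == q, [forall i in S, forall i' in S, J i == J i']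
    & #|counted_two_circuits S| == 2 * q].

Definition smart_pair := smart 2.
Definition smart_triplet := smart 3.

End Weingarten.

(* As usual for nat-valued \max, the value is 0 if there is no covering. *)
Definition p2_star (p d : nat) (g : 'I_p -> gidx d) : nat :=
  \max_(J : {ffun 'I_p -> 'I_d})
  \max_(C : {set {set edge p}} | circuit_covering g J C)
  \max_(A : {set {set 'I_p}}
        | finset.trivIset A && [forall S in A, smart_pair g J C S]) #|A|.

Definition p3_star (p d : nat) (g : 'I_p -> gidx d) : nat :=
  \max_(J : {ffun 'I_p -> 'I_d})
  \max_(C : {set {set edge p}} | circuit_covering g J C)
  \max_(AB : {set {set 'I_p}} * {set {set 'I_p}}
        | [&& finset.trivIset (AB.1 :|: AB.2)%SET,
              [forall S in AB.1, smart_pair g J C S],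
              #|AB.1| == p2_star g
            & [forall S in AB.2, smart_triplet g J C S]]) #|AB.2|.

(* Main.v *)
(* By unitarity, gamma(k,l,m,n) is the sum over j of the Wick product of its four
   factors, i.e. of their product with every internal pairing of a psi and a
   conjugated psi subtracted with weight 1/d.  Left invariance of the Haar
   measure gives the Schwinger-Dyson equation
     d E[psi_ak F] = sum over the conjugates of psi_ak in F of E[F without it]
                     - sum over the factors psi_jl of F of E[psi_al psi_jk (F without psi_jl)],
   where for Wick products only conjugates in other gamma terms contribute to
   the first sum.  Each step gains 1/d; removing an external pair or swapping the
   columns of two factors costs at most as much in the quantity
   d^(-(3/4) #factors + (1/2) x), with x the maximal number of disjoint external
   2-circuits, so that quantity bounds the expectation (and unbalanced
   configurations are smaller than any power of d).
   The identifications J of the j-indices with b distinct values number O(d^b).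
   A class of q terms with a common j contributes at most 2q to x, and nothing if
   q = 1; comparing exponents class by class, only pairs with 4 and triplets with
   6 external 2-circuits exceed the exponent 7/4 per term.  Finally, since being
   conjugate terms is a relation on which alternating paths close up, the pairs
   extend to a maximum family, each added pair destroying at most two triplets. *)

Require Import Defs.
From HB Require Import structures.
From mathcomp Require Import all_boot all_order all_algebra.
From mathcomp Require Import spectral complex.
From mathcomp Require Import all_classical all_reals all_analysis.
From mathcomp Require Import measurable_realfun.
From mathcomp Require Import ring lra zify.

Set Implicit Arguments.
Unset Strict Implicit.
Unset Printing Implicit Defensive.

Import Order.TTheory GRing.Theory Num.Theory numFieldNormedType.Exports.

Local Open Scope classical_set_scope.
Local Open Scope complex_scope.
Local Open Scope ring_scope.

(** * Expectations over a Haar unitary *)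

(** A swap keeps the number of factors and may raise x by two, so the recursion does not end on its
    own. The estimate is therefore stated with its exponent truncated at a level r and proved by
    induction on r: level 0 is the trivial bound, every use of the recursion brings a factor 1/d
    that pays for one more level, and r = 12 p covers all exponents that occur. Unbalanced
    configurations stay unbalanced under every step, so the same induction handles them. The weights
    make every term of the recursion break even at worst. Two external pairs created by a swap cost
    one factor d, which gives 1/2 per pair; deleting an external pair must also cost one factor d,
    which then gives 3/4 per factor. The numbers of smart pairs and triplets are maxima over all J.
    For a constant J a 2-circuit only requires equal columns, so disjoint sets found in the classes
    of any given J can be made smart simultaneously, in one covering supplied by column balance. *)

Lemma conjE (R : realType) (z : R[i]) : z^* = (conjc z)%C.
Proof. by []. Qed.

Lemma RealD (R : realType) (x y : R[i]) :
  complex.Re (x + y) = complex.Re x + complex.Re y.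
Proof. by case: x; case: y. Qed.

Lemma ImagD (R : realType) (x y : R[i]) :
  complex.Im (x + y) = complex.Im x + complex.Im y.
Proof. by case: x; case: y. Qed.

Lemma RealM (R : realType) (x y : R[i]) :
  complex.Re (x * y) =
    complex.Re x * complex.Re y - complex.Im x * complex.Im y.
Proof. by case: x; case: y. Qed.

Lemma ImagM (R : realType) (x y : R[i]) :
  complex.Im (x * y) =
    complex.Re x * complex.Im y + complex.Im x * complex.Re y.
Proof. by case: x; case: y. Qed.

Lemma norm_Real_le (R : realType) (z M : R[i]) :
  `|z| <= M -> `|complex.Re z| <= complex.Re M.
Proof.
move=> zM; have := le_trans (normc_ge_Re z) zM.
by rewrite lecE => /andP[].
Qed.

Lemma norm_Imag_le (R : realType) (z M : R[i]) :
  `|z| <= M -> `|complex.Im z| <= complex.Re M.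
Proof.
move=> zM; have -> : complex.Im z = - complex.Re (z * 'i%C).
  by rewrite complex.ReiNIm opprK.
rewrite normrN; apply: norm_Real_le; rewrite normrM.
suff -> : `|'i%C : R[i]| = 1 by rewrite mulr1.
by rewrite normc_def /= expr0n /= add0r expr1n sqrtr1.
Qed.

Section RealExpectation.
Context (R : realType) (disp : measure_display) (T : measurableType disp)
  (P : probability T R).

Definition bounded_measurable (f : T -> R) : Prop :=
  measurable_fun setT f /\ exists M, forall w, `|f w| <= M.

Lemma bounded_measurable_integrable (f : T -> R) :
  bounded_measurable f -> P.-integrable setT (EFin \o f).
Proof.
move=> [mf [M fM]]; apply: measurable_bounded_integrable => //.
  by rewrite (le_lt_trans (probability_le1 P _)) ?ltry.
exists M; split; first exact: num_real.
by move=> x Mx w _; apply: le_trans (fM w) (ltW Mx).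
Qed.

Lemma bounded_measurable_Lfun (f : T -> R) :
  bounded_measurable f -> f \in Lfun P 1.
Proof. by move=> hf; apply/Lfun1_integrable/bounded_measurable_integrable. Qed.

Lemma bounded_measurableZ (f : T -> R) (c : R) :
  bounded_measurable f -> bounded_measurable (fun w => c * f w).
Proof.
move=> [mf [M fM]]; split; first exact: measurable_funM.
exists (`|c| * M) => w; rewrite normrM; exact: ler_wpM2l.
Qed.

Lemma bounded_measurableD (f g : T -> R) :
  bounded_measurable f -> bounded_measurable g ->
  bounded_measurable (fun w => f w + g w).
Proof.
move=> [mf [M fM]] [mg [N gN]]; split; first exact: measurable_funD.
by exists (M + N) => w; apply: le_trans (ler_normD _ _) _; apply: lerD.
Qed.

Lemma fine_expectationD (f g : T -> R) :
  bounded_measurable f -> bounded_measurable g ->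
  fine 'E_P[fun w => f w + g w] = fine 'E_P[f] + fine 'E_P[g].
Proof.
move=> hf hg; rewrite [X in fine X = _](expectationD (bounded_measurable_Lfun hf)
  (bounded_measurable_Lfun hg)) fineD //;
  exact/expectation_fin_num/bounded_measurable_Lfun.
Qed.

Lemma fine_expectationZ (f : T -> R) (c : R) :
  bounded_measurable f -> fine 'E_P[fun w => c * f w] = c * fine 'E_P[f].
Proof.
move=> hf.
have -> : (fun w => c * f w) = c \o* f by apply/funext => w /=; rewrite mulrC.
rewrite expectationZl; last exact: bounded_measurable_Lfun.
by rewrite fineM //; exact/expectation_fin_num/bounded_measurable_Lfun.
Qed.

Lemma fine_expectation_cst (c : R) : fine 'E_P[fun _ => c] = c.
Proof. by rewrite (expectation_cst P c). Qed.

Lemma fine_expectation_ge0 (f : T -> R) :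
  (forall w, 0 <= f w) -> 0 <= fine 'E_P[f].
Proof. by move=> f0; apply: fine_ge0; apply: expectation_ge0. Qed.

Lemma bounded_measurable_cst (c : R) : bounded_measurable (fun _ => c).
Proof. by split; [exact: measurable_cst | exists `|c|]. Qed.

Lemma fine_expectation_le (f : T -> R) (M : R) :
  bounded_measurable f -> (forall w, `|f w| <= M) -> `|fine 'E_P[f]| <= M.
Proof.
move=> hf fM; rewrite ler_norml; apply/andP; split.
  have := @fine_expectation_ge0 (fun w => M + f w) _.
  rewrite fine_expectationD ?fine_expectation_cst //; last first.
    exact: bounded_measurable_cst.
  rewrite addrC -lerBlDr sub0r; apply => w.
  by rewrite addrC -lerBlDr sub0r; have := fM w; rewrite ler_norml => /andP[].
have := @fine_expectation_ge0 (fun w => M + (-1) * f w) _.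
rewrite fine_expectationD ?fine_expectation_cst; last 2 first.
- exact: bounded_measurable_cst.
- exact: bounded_measurableZ.
rewrite fine_expectationZ // mulN1r subr_ge0; apply => w.
by rewrite mulN1r subr_ge0; have := fM w; rewrite ler_norml => /andP[].
Qed.

(** Both expectations integrate the identity against the law. This turns Haar invariance, stated for
    events, into invariance of expectations. *)
Lemma expectation_eq_law (f g : T -> R) :
  bounded_measurable f -> bounded_measurable g ->
  (forall Y : set R, measurable Y -> P (f @^-1` Y) = P (g @^-1` Y)) ->
  ('E_P[f] = 'E_P[g])%E.
Proof.
move=> hf hg fg.
pose hf' := isMeasurableFun.Build _ _ T R f hf.1.
pose F : {RV P >-> R} := HB.pack f hf'.
pose hg' := isMeasurableFun.Build _ _ T R g hg.1.
pose G : {RV P >-> R} := HB.pack g hg'.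
rewrite unlock.
rewrite -(@integral_distribution _ _ T R R P F (@EFin R)); last 2 first.
- exact: EFin_measurable.
- exact: bounded_measurable_integrable.
rewrite -(@integral_distribution _ _ T R R P G (@EFin R)); last 2 first.
- exact: EFin_measurable.
- exact: bounded_measurable_integrable.
apply: eq_measure_integral => Y mY _; exact: fg.
Qed.

End RealExpectation.

Section Measurability.
Context (R : realType) (d : nat).

Lemma Re_continuous : continuous (fun z : R[i]^o => complex.Re (z : R[i])).
Proof.
move=> x A /nbhs_ballP[e e0 eA]; apply/nbhs_ballP.
exists (e%:C); first by rewrite /= ltcR.
move=> y /= xy; apply: eA; rewrite /ball /= -raddfB -ltcR.
exact: le_lt_trans (normc_ge_Re _) xy.
Qed.

Lemma Im_continuous : continuous (fun z : R[i]^o => complex.Im (z : R[i])).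
Proof.
move=> x A /nbhs_ballP[e e0 eA]; apply/nbhs_ballP.
exists (e%:C); first by rewrite /= ltcR.
move=> y /= xy; apply: eA; rewrite /ball /= -raddfB.
apply: le_lt_trans (norm_Imag_le (lexx `|x - y|)) _.
by move: xy; rewrite -ball_normE /= ltcE => /andP[].
Qed.

Lemma entry_continuous (j k : 'I_d) :
  continuous (fun psi : 'M[R[i]^o]_d => psi j k).
Proof. exact: coord_continuous. Qed.

Lemma continuous_borelM (f : 'M[R[i]^o]_d -> R) :
  continuous f -> measurable_fun setT (f : borelM R d -> R).
Proof.
move=> /continuousP cf.
apply: (measurability _ (RGenOInfty.measurableE R)) => _ [_ [x ->] <-].
rewrite setTI; apply: sub_sigma_algebra; apply: cf.
rewrite set_itvE; exact: open_gt.
Qed.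

Lemma measurable_Re_entry (j k : 'I_d) :
  measurable_fun setT (fun psi : borelM R d => complex.Re (psi j k)).
Proof.
apply: (@continuous_borelM (fun psi => complex.Re (psi j k))) => psi.
apply: (@continuous_comp _ _ _ (fun psi : 'M[R[i]^o]_d => psi j k)
  (fun z : R[i]^o => complex.Re z)).
  exact: entry_continuous.
exact: Re_continuous.
Qed.

Lemma measurable_Im_entry (j k : 'I_d) :
  measurable_fun setT (fun psi : borelM R d => complex.Im (psi j k)).
Proof.
apply: (@continuous_borelM (fun psi => complex.Im (psi j k))) => psi.
apply: (@continuous_comp _ _ _ (fun psi : 'M[R[i]^o]_d => psi j k)
  (fun z : R[i]^o => complex.Im z)).
  exact: entry_continuous.
exact: Im_continuous.
Qed.

End Measurability.

Section ComplexExpectation.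
Context (R : realType) (disp : measure_display) (T : measurableType disp)
  (P : probability T R).

Definition bounded_cmeasurable (X : T -> R[i]) : Prop :=
  bounded_measurable (fun w => complex.Re (X w)) /\
  bounded_measurable (fun w => complex.Im (X w)).

Lemma cexpectationD (X Y : T -> R[i]) :
  bounded_cmeasurable X -> bounded_cmeasurable Y ->
  cexpectation P (fun w => X w + Y w) = cexpectation P X + cexpectation P Y.
Proof.
move=> [X1 X2] [Y1 Y2]; rewrite /cexpectation.
under eq_fun do rewrite RealD.
under [in X in _ +i* X]eq_fun do rewrite ImagD.
by rewrite !fine_expectationD.
Qed.

Lemma cexpectation_cst (c : R[i]) : cexpectation P (fun _ => c) = c.
Proof. by rewrite /cexpectation !fine_expectation_cst; case: c. Qed.

Lemma cexpectationZ (c : R[i]) (X : T -> R[i]) :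
  bounded_cmeasurable X ->
  cexpectation P (fun w => c * X w) = c * cexpectation P X.
Proof.
move=> [X1 X2]; rewrite /cexpectation.
under eq_fun do rewrite RealM -mulNr.
under [in X in _ +i* X]eq_fun do rewrite ImagM.
rewrite !fine_expectationD; try exact: bounded_measurableZ.
rewrite !fine_expectationZ //; case: c => a b /=.
by rewrite mulNr.
Qed.

(** The factor 2 comes from bounding the real and imaginary parts separately. *)
Lemma cexpectation_norm_le (X : T -> R[i]) (M : R[i]) :
  bounded_cmeasurable X -> (forall w, `|X w| <= M) ->
  `|cexpectation P X| <= 2 * M.
Proof.
move=> [X1 X2] XM.
have M0 : 0 <= M by apply: le_trans (XM point).
have rM : (complex.Re M)%:C = M by apply: RRe_real; exact: ger0_real.
have h1 := fine_expectation_le P X1 (fun w => norm_Real_le (XM w)).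
have h2 := fine_expectation_le P X2 (fun w => norm_Imag_le (XM w)).
rewrite /cexpectation; set a := fine _ in h1 *; set b := fine _ in h2 *.
have -> : a +i* b = a%:C + 'i%C * b%:C by rewrite [LHS]complexE.
apply: le_trans (ler_normD _ _) _; rewrite normrM.
have -> : `|'i%C : R[i]| = 1.
  by rewrite normc_def /= expr0n /= add0r expr1n sqrtr1.
rewrite mul1r mulr_natl mulr2n -rM.
have nC (x : R) : `|x%:C| = `|x|%:C.
  by rewrite normc_def /= expr0n /= addr0 sqrtr_sqr.
by apply: lerD; rewrite nC lecR.
Qed.

End ComplexExpectation.

(** * Polynomials in the entries and their conjugates *)

Section Polynomials.
Context (R : realType) (d : nat).
Local Notation C := R[i].
Local Notation mx := 'M[C]_d.

(** A class of integrands that is closed under translation, measurable, and bounded on unitary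
    matrices, so that expectations are linear on it. *)
Inductive poly_fun : (mx -> C) -> Prop :=
| PolyCst c : poly_fun (fun _ => c)
| PolyEntry j k : poly_fun (fun psi => psi j k)
| PolyConj j k : poly_fun (fun psi => (psi j k)^*)
| PolyAdd F G : poly_fun F -> poly_fun G -> poly_fun (fun psi => F psi + G psi)
| PolyMul F G : poly_fun F -> poly_fun G -> poly_fun (fun psi => F psi * G psi).

Lemma poly_sum (I : Type) (s : seq I) (Q : pred I) (F : I -> mx -> C) :
  (forall i, poly_fun (F i)) ->
  poly_fun (fun psi => \sum_(i <- s | Q i) F i psi).
Proof.
move=> pF; elim: s => [|i s IH].
  by under eq_fun do rewrite big_nil; exact: PolyCst.
under eq_fun do rewrite big_cons.
by case: (Q i) => //; exact: PolyAdd.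
Qed.

Lemma poly_opp (F : mx -> C) : poly_fun F -> poly_fun (fun psi => - F psi).
Proof.
move=> pF; under eq_fun do rewrite -mulN1r.
by apply: PolyMul => //; exact: PolyCst.
Qed.

Lemma poly_prod (I : Type) (s : seq I) (Q : pred I) (F : I -> mx -> C) :
  (forall i, poly_fun (F i)) ->
  poly_fun (fun psi => \prod_(i <- s | Q i) F i psi).
Proof.
move=> pF; elim: s => [|i s IH].
  by under eq_fun do rewrite big_nil; exact: PolyCst.
under eq_fun do rewrite big_cons.
by case: (Q i) => //; exact: PolyMul.
Qed.

Lemma poly_measurable (F : mx -> C) : poly_fun F ->
  measurable_fun setT (fun psi : borelM R d => complex.Re (F psi)) /\
  measurable_fun setT (fun psi : borelM R d => complex.Im (F psi)).
Proof.
elim=> {F} [c|j k|j k|F G _ [F1 F2] _ [G1 G2]|F G _ [F1 F2] _ [G1 G2]].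
- by split; exact: measurable_cst.
- by split; [exact: measurable_Re_entry | exact: measurable_Im_entry].
- split.
    have -> : (fun psi : borelM R d => complex.Re ((psi j k)^*)) =
              (fun psi => complex.Re (psi j k)).
      by apply/funext => psi; rewrite conjE; case: (psi j k).
    exact: measurable_Re_entry.
  have -> : (fun psi : borelM R d => complex.Im ((psi j k)^*)) =
            (fun psi => - complex.Im (psi j k)).
    by apply/funext => psi; rewrite conjE; case: (psi j k).
  by apply: measurableT_comp => //; exact: measurable_Im_entry.
- split.
    by under eq_fun do rewrite RealD; exact: measurable_funD.
  by under eq_fun do rewrite ImagD; exact: measurable_funD.
- split.
    under eq_fun do rewrite RealM.
    by apply: measurable_funB; exact: measurable_funM.
  under eq_fun do rewrite ImagM.
  by apply: measurable_funD; exact: measurable_funM.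
Qed.

Lemma unitary_adjoint (psi : mx) (k l : 'I_d) : psi \is unitarymx ->
  \sum_b psi b k * (psi b l)^* = (k == l)%:R.
Proof.
move=> /unitarymxP/mulmx1C/matrixP/(_ l k).
rewrite !mxE eq_sym => <-; apply: eq_bigr => b _.
by rewrite !mxE mulrC.
Qed.

Lemma unitary_entry_le1 (psi : mx) (j k : 'I_d) :
  psi \is unitarymx -> `|psi j k| <= 1.
Proof.
move=> /(unitary_adjoint k k); rewrite eqxx mulr1n => h.
rewrite -(@ler_pXn2r _ 2) ?nnegrE // expr1n -h (bigD1 j) //= normCK.
by rewrite lerDl sumr_ge0 // => b _; rewrite -normCK exprn_ge0.
Qed.

Lemma poly_bounded (F : mx -> C) : poly_fun F ->
  exists2 M : C, 0 <= M & forall psi, psi \is unitarymx -> `|F psi| <= M.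
Proof.
elim=> {F} [c|j k|j k|F G _ [M M0 FM] _ [N N0 GN]|F G _ [M M0 FM] _ [N N0 GN]].
- by exists `|c|.
- by exists 1 => // psi /unitary_entry_le1.
- by exists 1 => // psi /unitary_entry_le1 h; rewrite norm_conjC.
- exists (M + N); first exact: addr_ge0.
  move=> psi u; apply: le_trans (ler_normD _ _) _.
  by apply: lerD; [exact: FM | exact: GN].
- exists (M * N); first exact: mulr_ge0.
  by move=> psi u; rewrite normrM; apply: ler_pM => //; [exact: FM | exact: GN].
Qed.

Lemma poly_translate (U : mx) (F : mx -> C) : poly_fun F ->
  poly_fun (fun psi => F (U *m psi)).
Proof.
elim=> {F} [c|j k|j k|F G _ F1 _ G1|F G _ F1 _ G1].
- exact: PolyCst.
- under eq_fun do rewrite mxE; apply: poly_sum => b.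
  by apply: PolyMul; [exact: PolyCst | exact: PolyEntry].
- under eq_fun do rewrite mxE rmorph_sum; apply: poly_sum => b.
  under eq_fun do rewrite rmorphM.
  by apply: PolyMul; [exact: PolyCst | exact: PolyConj].
- exact: PolyAdd.
- exact: PolyMul.
Qed.

End Polynomials.

(** * Haar expectations of polynomials *)

Section Haar.
Context (R : realType) (d : nat) (disp : measure_display)
  (T : measurableType disp) (P : probability T R) (Psi : T -> 'M[R[i]]_d)
  (hPsi : haar_unitary P Psi).
Local Notation C := R[i].
Local Notation mx := 'M[C]_d.
Local Notation E F := (cexpectation P (fun w => F (Psi w))).

Lemma poly_bounded_cmeasurable (F : mx -> C) :
  poly_fun F -> bounded_cmeasurable (fun w => F (Psi w)).
Proof.
move: hPsi => [mPsi uPsi _ _] pF.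
have [M M0 FM] := poly_bounded pF.
have [mR mI] := poly_measurable pF.
split; split.
- exact: (measurableT_comp mR mPsi).
- by exists (complex.Re M) => w; exact/norm_Real_le/FM.
- exact: (measurableT_comp mI mPsi).
- by exists (complex.Re M) => w; exact/norm_Imag_le/FM.
Qed.

Lemma haar_invariance (U : mx) (F : mx -> C) : U \is unitarymx -> poly_fun F ->
  E (fun psi => F (U *m psi)) = E F.
Proof.
move=> uU pF.
have [_ _ inv _] := hPsi.
have [h1 h2] := poly_bounded_cmeasurable pF.
have [k1 k2] := poly_bounded_cmeasurable (poly_translate U pF).
have [mR mI] := poly_measurable pF.
rewrite /cexpectation.
rewrite (expectation_eq_law k1 h1); last first.
  move=> Y mY; apply: (inv U uU (fun psi => Y (complex.Re (F psi))) _).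
  by rewrite -[X in measurable X]setTI; exact: mR.
rewrite (expectation_eq_law k2 h2) // => Y mY.
apply: (inv U uU (fun psi => Y (complex.Im (F psi))) _).
by rewrite -[X in measurable X]setTI; exact: mI.
Qed.

Lemma EpolyD (F G : mx -> C) : poly_fun F -> poly_fun G ->
  E (fun psi => F psi + G psi) = E F + E G.
Proof. by move=> pF pG; apply: cexpectationD; exact: poly_bounded_cmeasurable. Qed.

Lemma EpolyZ (c : C) (F : mx -> C) : poly_fun F ->
  E (fun psi => c * F psi) = c * E F.
Proof. by move=> pF; apply: cexpectationZ; exact: poly_bounded_cmeasurable. Qed.

Lemma EpolyN (F : mx -> C) : poly_fun F -> E (fun psi => - F psi) = - E F.
Proof. by move=> pF; under eq_fun do rewrite -mulN1r; rewrite EpolyZ // mulN1r. Qed.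

Lemma EpolyB (F G : mx -> C) : poly_fun F -> poly_fun G ->
  E (fun psi => F psi - G psi) = E F - E G.
Proof. by move=> pF pG; rewrite (EpolyD pF (poly_opp pG)) (EpolyN pG). Qed.

Lemma Epoly_sum (I : Type) (s : seq I) (Q : pred I) (F : I -> mx -> C) :
  (forall i, poly_fun (F i)) ->
  E (fun psi => \sum_(i <- s | Q i) F i psi) = \sum_(i <- s | Q i) E (F i).
Proof.
move=> pF; elim: s => [|i s IH].
  by under eq_fun do rewrite big_nil; rewrite cexpectation_cst big_nil.
under eq_fun do rewrite big_cons; rewrite big_cons.
by case: (Q i) => //; rewrite (EpolyD (pF i) (poly_sum s Q pF)) IH.
Qed.

Lemma Epoly_norm_le (F : mx -> C) (M : C) : poly_fun F ->
  (forall psi, psi \is unitarymx -> `|F psi| <= M) -> `|E F| <= 2 * M.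
Proof.
move=> pF FM; apply: cexpectation_norm_le; first exact: poly_bounded_cmeasurable.
by move=> w; apply: FM; case: hPsi.
Qed.

Lemma Epoly_eq (F G : mx -> C) :
  (forall psi, psi \is unitarymx -> F psi = G psi) -> E F = E G.
Proof.
by move=> FG; congr cexpectation; apply/funext => w; apply: FG; case: hPsi.
Qed.

End Haar.

(** * Schwinger-Dyson equations *)

(** The identity says that 1 + delta has modulus 1. The witness is a Cayley transform: 1 + delta =
    (1 + i e) / (1 - i e). *)
Lemma unit_phase_increment (C : numClosedFieldType) (e : C) : 0 < e ->
  exists2 delta : C, 0 < `|delta| <= 2 * e & delta^* = - delta - `|delta| ^+ 2.
Proof.
move=> e0.
have ec : e^* = e by apply/CrealP/gtr0_real.
set q := 1 - 'i * e.
have qc : q^* = 1 + 'i * e by rewrite rmorphB rmorphM rmorph1 /= ec conjCi mulNr opprK.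
have q1 : 1 <= `|q|.
  rewrite -(@ler_pXn2r _ 2) ?nnegrE // expr1n normCK qc.
  rewrite (_ : q * _ = 1 - 'i ^+ 2 * e ^+ 2); last by rewrite /q; ring.
  by rewrite sqrCi mulN1r opprK lerDl exprn_ge0 // ltW.
have q0 : q != 0 by rewrite -normr_gt0 (lt_le_trans ltr01).
have qc0 : 1 + 'i * e != 0 by rewrite -qc fmorph_eq0.
have nq : `|2 * 'i * e| = 2 * e.
  by rewrite !normrM normCi mulr1 (gtr0_norm e0) normr_nat.
exists (2 * 'i * e / q).
  rewrite normf_div nq; apply/andP; split.
    by rewrite divr_gt0 ?mulr_gt0 // (lt_le_trans ltr01).
  by rewrite ler_piMr ?mulr_ge0 ?(ltW e0) // invf_le1 // (lt_le_trans ltr01).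
rewrite normCK !rmorphM fmorphV /= qc conjCi ec rmorph_nat.
by rewrite /q in q0 *; field; rewrite q0 qc0.
Qed.

Section Derivations.
Context (R : realType) (d : nat).
Local Notation C := R[i].
Local Notation mx := 'M[C]_d.

(* [F' x y] is the derivative of [F] along the vector field [E_xy *m psi], where
   E_xy is a matrix unit, extended complex-linearly from antihermitian matrices. *)
Inductive has_derivations : (mx -> C) -> ('I_d -> 'I_d -> mx -> C) -> Prop :=
| DerCst c : has_derivations (fun _ => c) (fun _ _ _ => 0)
| DerEntry j k : has_derivations (fun psi => psi j k)
    (fun x y psi => (j == x)%:R * psi y k)
| DerConj j k : has_derivations (fun psi => (psi j k)^*)
    (fun x y psi => - (j == y)%:R * (psi x k)^*)
| DerAdd F G F' G' : has_derivations F F' -> has_derivations G G' ->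
    has_derivations (fun psi => F psi + G psi)
      (fun x y psi => F' x y psi + G' x y psi)
| DerMul F G F' G' : has_derivations F F' -> has_derivations G G' ->
    has_derivations (fun psi => F psi * G psi)
      (fun x y psi => F psi * G' x y psi + F' x y psi * G psi).

Lemma has_derivations_poly F F' : has_derivations F F' ->
  poly_fun F /\ (forall x y, poly_fun (F' x y)).
Proof.
elim=> {F F'} [c|j k|j k|F G F' G' _ [F1 F2] _ [G1 G2]
             |F G F' G' _ [F1 F2] _ [G1 G2]]; split => [|x y].
- exact: PolyCst.
- exact: PolyCst.
- exact: PolyEntry.
- by apply: PolyMul; [exact: PolyCst | exact: PolyEntry].
- exact: PolyConj.
- by apply: PolyMul; [exact: PolyCst | exact: PolyConj].
- exact: PolyAdd.
- exact: PolyAdd.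
- exact: PolyMul.
- by apply: PolyAdd; exact: PolyMul.
Qed.

Definition directional (Pi : mx) (F' : 'I_d -> 'I_d -> mx -> C) (psi : mx) : C :=
  \sum_x \sum_y Pi x y * F' x y psi.

Lemma directional_poly Pi F F' : has_derivations F F' ->
  poly_fun (directional Pi F').
Proof.
move=> /has_derivations_poly[_ pF']; apply: poly_sum => x; apply: poly_sum => y.
by apply: PolyMul => //; exact: PolyCst.
Qed.

(** Idempotence collapses the product with the adjoint to 1 + (delta + delta^* + |delta|^2) Pi.
    Moving along projections thus stays exactly unitary without matrix exponentials. *)
Lemma unitary_increment (Pi : mx) (delta : C) :
  (Pi ^t*)%sesqui = Pi -> Pi *m Pi = Pi -> delta^* = - delta - `|delta| ^+ 2 ->
  1%:M + delta *: Pi \is unitarymx.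
Proof.
move=> Pih Pip hd; apply/unitarymxP.
rewrite linearD linearZ /= map_mxD map_mxZ trmx1 map_mx1 Pih.
rewrite mulmxDl !mulmxDr !mul1mx !mulmx1 -scalemxAr -!scalemxAl Pip scalerA.
have key : delta^* + delta + delta^* * delta = 0.
  by rewrite [_^* * _]mulrC -normCK hd; ring.
by rewrite -!addrA -!scalerDl /= addrA key scale0r addr0.
Qed.

(** The error is uniform in [psi] so that it survives the expectation. Entries move linearly;
    conjugated entries leave an error because the conjugate of delta is -delta only up to |delta|^2;
    products multiply the expansions. *)
Lemma first_order_expansion (Pi : mx) F F' :
  (Pi ^t*)%sesqui = Pi -> Pi *m Pi = Pi -> has_derivations F F' ->
  exists2 M : C, 0 <= M & forall delta psi, `|delta| <= 2 ->
    delta^* = - delta - `|delta| ^+ 2 -> psi \is unitarymx ->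
    `|F ((1%:M + delta *: Pi) *m psi) - F psi - delta * directional Pi F' psi|
      <= M * `|delta| ^+ 2.
Proof.
move=> Pih Pip.
have mulE delta (psi : mx) j k : ((1%:M + delta *: Pi) *m psi) j k =
    psi j k + delta * \sum_b Pi j b * psi b k.
  rewrite mulmxDl mul1mx -scalemxAl !mxE; congr (_ + _ * _).
elim=> {F F'} [c|j k|j k|F G F' G' _ [M M0 hF] _ [N N0 hG]|F G F' G' dF [M M0 hF] dG [N N0 hG]].
- exists 0 => // delta psi _ _ _.
  rewrite /directional big1 ?mulr0 ?subrr ?normr0 ?mul0r // => x _.
  by rewrite big1 // => y _; rewrite mulr0.
- exists 0 => // delta psi _ _ _; rewrite mul0r mulE.
  rewrite (_ : directional _ _ _ = \sum_b Pi j b * psi b k); last first.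
    rewrite /directional (bigD1 j) //= [X in _ + X]big1 ?addr0 => [|x xj].
      by apply: eq_bigr => y _; rewrite eqxx mul1r.
    rewrite big1 // => y _.
    by rewrite eq_sym (negPf xj) mul0r mulr0.
  by rewrite [X in `|X|](_ : _ = 0) ?normr0 //; ring.
- have pS : poly_fun (fun psi : mx => \sum_b Pi j b * psi b k).
    by apply: poly_sum => b; apply: PolyMul; [exact: PolyCst | exact: PolyEntry].
  have [B B0 hB] := poly_bounded pS.
  exists B => // delta psi _ hd u; rewrite mulE rmorphD rmorphM /= hd.
  rewrite (_ : directional _ _ _ = - (\sum_b Pi j b * psi b k)^*); last first.
    rewrite /directional exchange_big (bigD1 j) //= [X in _ + X]big1 ?addr0.
      rewrite rmorph_sum -sumrN; apply: eq_bigr => y _.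
      rewrite eqxx mulN1r mulrN rmorphM; congr (- (_ * _)).
      by have /matrixP/(_ y j) := Pih; rewrite !mxE => <-.
    move=> x xj; rewrite big1 // => y _.
    by rewrite eq_sym (negPf xj) oppr0 mul0r mulr0.
  have := hB psi u; set S := \sum_b _ => SB.
  rewrite [X in `|X|](_ : _ = - (`|delta| ^+ 2 * S^*)); last by ring.
  by rewrite normrN normrM norm_conjC normrX normr_id mulrC ler_wpM2r ?exprn_ge0.
- exists (M + N) => [|delta psi d2 hd u]; first exact: addr_ge0.
  rewrite (_ : directional _ _ _ = directional Pi F' psi + directional Pi G' psi).
    rewrite mulrDl; apply: le_trans (lerD (hF _ _ d2 hd u) (hG _ _ d2 hd u)).
    apply: le_trans (ler_normD _ _); rewrite le_eqVlt; apply/orP; left.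
    by apply/eqP; congr `|_|; ring.
  rewrite /directional -big_split; apply: eq_bigr => x _.
  by rewrite -big_split; apply: eq_bigr => y _; rewrite mulrDr.
- have [BF BF0 hBF] := poly_bounded (has_derivations_poly dF).1.
  have [BG BG0 hBG] := poly_bounded (has_derivations_poly dG).1.
  have [DF DF0 hDF] := poly_bounded (directional_poly Pi dF).
  have [DG DG0 hDG] := poly_bounded (directional_poly Pi dG).
  exists (BF * N + M * BG + 2 * M * DG + DF * DG) => [|delta psi d2 hd u].
    by rewrite !addr_ge0 ?mulr_ge0.
  rewrite (_ : directional _ _ _ =
      F psi * directional Pi G' psi + directional Pi F' psi * G psi); last first.
    rewrite /directional mulr_sumr mulr_suml -big_split; apply: eq_bigr => x _.
    rewrite mulr_sumr mulr_suml -big_split; apply: eq_bigr => y _ /=; ring.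
  have uU := mul_unitarymx (unitary_increment Pih Pip hd) u.
  have := hF _ _ d2 hd u; have := hG _ _ d2 hd u; have := hBF _ uU.
  have := hBG _ u; have := hDF _ u; have := hDG _ u.
  set fU := F (_ *m psi); set gU := G (_ *m psi).
  set f := F psi; set g := G psi; set f' := directional _ F' _.
  set g' := directional _ G' _ => h1 h2 h3 h4 h5 h6.
  (* Product rule with remainders; [|delta| <= 2] is spent on the third summand, where a remainder
     meets [delta]. *)
  rewrite [X in `|X|](_ : _ = fU * (gU - g - delta * g') +
     (fU - f - delta * f') * g + delta * ((fU - f - delta * f') * g') +
      delta ^+ 2 * (f' * g')); last by ring.
  rewrite [leRHS](_ : _ = BF * (N * `|delta| ^+ 2) + M * `|delta| ^+ 2 * BG +
     2 * (M * `|delta| ^+ 2 * DG) + `|delta| ^+ 2 * (DF * DG)); last by ring.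
  apply: le_trans (ler_normD _ _) (lerD _ _); last first.
    by rewrite normrM normrX ler_wpM2l ?exprn_ge0 // normrM ler_pM.
  apply: le_trans (ler_normD _ _) (lerD _ _); last first.
    by rewrite !normrM ler_pM // ?mulr_ge0 // ler_pM.
  apply: le_trans (ler_normD _ _) (lerD _ _); by rewrite normrM ler_pM.
Qed.

Lemma rank_one_projection (v : 'cV[C]_d) (c : R) : c != 0 ->
  (v ^t*)%sesqui *m v = (c%:C)%:M ->
  let Pi := (c%:C)^-1 *: (v *m (v ^t*)%sesqui) in
  (Pi ^t*)%sesqui = Pi /\ Pi *m Pi = Pi.
Proof.
move=> c0 vv Pi; split.
  rewrite /Pi linearZ /= map_mxZ trmx_mul map_mxM /=; congr (_ *: _).
    by rewrite fmorphV /= conjE conjc_real.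
  congr (_ *m _); apply/matrixP => i j; rewrite !mxE; exact: conjCK.
rewrite /Pi -scalemxAl -scalemxAr scalerA mulmxA -(mulmxA v) vv.
rewrite mul_mx_scalar -scalemxAl scalerA mulrVK // unitfE.
by rewrite -[0]/(0%:C) (inj_eq (@complexI R)).
Qed.

End Derivations.

Section SchwingerDyson.
Context (R : realType) (d : nat) (disp : measure_display)
  (T : measurableType disp) (P : probability T R) (Psi : T -> 'M[R[i]]_d)
  (hPsi : haar_unitary P Psi).
Local Notation C := R[i].
Local Notation mx := 'M[C]_d.
Local Notation E F := (cexpectation P (fun w => F (Psi w))).

(** By invariance, [delta] times this expectation is an error of order |delta|^2 for arbitrarily
    small [delta]. *)
Lemma directional_expectation0 (Pi : mx) F F' :
  (Pi ^t*)%sesqui = Pi -> Pi *m Pi = Pi -> has_derivations F F' ->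
  E (directional Pi F') = 0.
Proof.
move=> Pih Pip dF.
have [M M0 hM] := first_order_expansion Pih Pip dF.
have pF := (has_derivations_poly dF).1.
have pD := directional_poly Pi dF.
set h := E _; apply/eqP; apply: contraT; rewrite -normr_gt0 => h0.
have bound delta : 0 < `|delta| -> `|delta| <= 2 ->
    delta^* = - delta - `|delta| ^+ 2 -> `|h| <= 2 * M * `|delta|.
  move=> d0 d2 hd.
  have uU := unitary_increment Pih Pip hd.
  have pFU := poly_translate (1%:M + delta *: Pi) pF.
  have pB := PolyAdd (PolyAdd pFU (poly_opp pF))
    (poly_opp (PolyMul (PolyCst _ delta) pD)).
  have := Epoly_norm_le hPsi pB (fun psi => hM delta psi d2 hd).
  rewrite (EpolyB hPsi (PolyAdd pFU (poly_opp pF))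
    (PolyMul (PolyCst _ delta) pD)).
  rewrite (EpolyB hPsi pFU pF) (haar_invariance hPsi uU pF) subrr sub0r normrN.
  rewrite (EpolyZ hPsi delta pD) normrM -/h expr2 !mulrA mulrC.
  by rewrite ler_pM2r.
(* With e = |h| / q the bound becomes |h| <= 4 M |h| / q, impossible as q > 4 M. The summand |h| of
   q makes e <= 1, hence |delta| <= 2. *)
pose q := 4 * M + 1 + `|h|.
have q0 : 0 < q by rewrite /q addr_gt0 // ltr_wpDl // mulr_ge0.
have [delta /andP[d0 de] hd] := unit_phase_increment (divr_gt0 h0 q0).
have hq1 : `|h| / q <= 1 by rewrite ler_pdivrMr // mul1r lerDr addr_ge0 // mulr_ge0.
have d2 : `|delta| <= 2 by apply: le_trans de _; rewrite ger_pMr.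
have := le_trans (bound _ d0 d2 hd) (ler_wpM2l (mulr_ge0 (ler0n _ 2) M0) de).
rewrite [leRHS](_ : _ = (4 * M * `|h|) / q); last by ring.
rewrite ler_pdivlMr // [leRHS]mulrC ler_pM2l // /q -addrA gerDl.
by move=> /(lt_le_trans (ltr_pwDl ltr01 (ltW h0))); rewrite ltxx.
Qed.

(** Polarization: projections onto basis vectors give the diagonal generators, and those onto e_x +
    w e_y with w = 1 and w = i separate the two off-diagonal ones. *)
Lemma derivation_expectation0 F F' x y : has_derivations F F' ->
  E (F' x y) = 0.
Proof.
move=> dF.
have pF' := (has_derivations_poly dF).2.
have form (v : 'cV[C]_d) (c : R) : c != 0 -> (v ^t*)%sesqui *m v = (c%:C)%:M ->
    \sum_i \sum_j v i 0 * (v j 0)^* * E (F' i j) = 0.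
  move=> c0 vv; have [h1 h2] := rank_one_projection c0 vv.
  have := directional_expectation0 h1 h2 dF.
  have pij i j : poly_fun (fun psi => (c%:C^-1 *: (v *m (v ^t*)%sesqui)) i j * F' i j psi).
    by apply: PolyMul => //; exact: PolyCst.
  rewrite (Epoly_sum hPsi (index_enum 'I_d) predT
    (fun i => poly_sum (index_enum 'I_d) predT (pij i))).
  move=> /(congr1 (fun z => c%:C * z)); rewrite mulr0 mulr_sumr => e; rewrite -[RHS]e.
  apply: eq_bigr => i _; rewrite (Epoly_sum hPsi (index_enum 'I_d) predT (pij i)).
  rewrite mulr_sumr; apply: eq_bigr => j _.
  rewrite (EpolyZ hPsi _ (pF' i j)) mulrA; congr (_ * _).
  rewrite !mxE big_ord1 !mxE mulrA divff ?mul1r //.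
  by rewrite -[0]/(0%:C) (inj_eq (@complexI R)).
have pair (w : C) (i : 'I_d) (g : 'I_d -> C) (j : 'I_d) :
    \sum_k ((k == i)%:R + w * (k == j)%:R) * g k = g i + w * g j.
  under eq_bigr do rewrite mulrDl -mulrA.
  rewrite big_split /= -mulr_sumr (bigD1 i) //= eqxx mul1r big1 ?addr0.
    rewrite (bigD1 j) //= eqxx mul1r big1 ?addr0 // => k kj.
    by rewrite (negPf kj) mul0r.
  by move=> k ki; rewrite (negPf ki) mul0r.
have diag i : E (F' i i) = 0.
  (* The zero summand brings the basis vector into the shape that [pair] evaluates. *)
  pose v : 'cV[C]_d := \col_k ((k == i)%:R + 0 * (k == i)%:R).
  have vv : (v ^t*)%sesqui *m v = (1%:C)%:M.
    apply/matrixP => a b; rewrite !mxE (ord1 a) (ord1 b) eqxx mulr1n.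
    under eq_bigr => k _ do rewrite !mxE mulrC.
    by rewrite pair !mul0r !addr0 eqxx rmorph1.
  have := form v 1 (oner_neq0 _) vv.
  under eq_bigr => a _ do under eq_bigr => b _ do
    rewrite !mxE rmorphD rmorphM /= rmorph0 !rmorph_nat -mulrA.
  under eq_bigr => a _ do rewrite -mulr_sumr.
  by rewrite !pair !mul0r !addr0.
have [<-|xy] := eqVneq x y; first exact: diag.
have off (w : C) : `|w| = 1 -> w^* * E (F' x y) + w * E (F' y x) = 0.
  move=> w1.
  have w2 : w * w^* = 1 by rewrite -normCK w1 expr1n.
  pose v : 'cV[C]_d := \col_k ((k == x)%:R + w * (k == y)%:R).
  have vv : (v ^t*)%sesqui *m v = ((2%:R)%:C)%:M.
    apply/matrixP => a b; rewrite !mxE (ord1 a) (ord1 b) eqxx mulr1n.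
    under eq_bigr => k _ do rewrite !mxE mulrC.
    rewrite pair !eqxx [y == x]eq_sym (negPf xy) !mulr0 mulr1 addr0 add0r rmorph1.
    by rewrite w2 rmorph_nat.
  have two0 : 2%:R != 0 :> R by rewrite pnatr_eq0.
  have := form v _ two0 vv.
  under eq_bigr => a _ do under eq_bigr => b _ do
    rewrite !mxE rmorphD rmorphM /= !rmorph_nat -mulrA.
  under eq_bigr => a _ do rewrite -mulr_sumr.
  by rewrite !pair !diag mulr0 add0r addr0.
have h1 := off 1 (normr1 _); rewrite rmorph1 !mul1r in h1.
have hi := off 'i (normCi _); rewrite conjCi in hi.
have i2 : 2 * 'i != 0 :> C by rewrite mulf_neq0 ?pnatr_eq0 ?neq0Ci.
apply: (mulfI i2); rewrite mulr0.
move: h1 hi; set X : C := E _; set Y : C := E _ => h1 hi.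
have -> : 2 * 'i * X = 'i * (X + Y) - (- 'i * X + 'i * Y) by ring.
by rewrite h1 hi mulr0 subr0.
Qed.

(* The generators E_ba applied to [psi b k * F] and summed over [b]: the first
   factor produces [d * psi a k * F], and [H] collects the action on [F]. *)
Lemma schwinger_dyson (a k : 'I_d) F F' (H : mx -> C) :
  has_derivations F F' ->
  (forall psi, psi \is unitarymx -> \sum_b psi b k * F' b a psi = H psi) ->
  E (fun psi : mx => d%:R * (psi a k * F psi)) = - E H.
Proof.
move=> dF FH.
have [pF pF'] := has_derivations_poly dF.
have pB b : poly_fun (fun psi : mx => psi b k * F' b a psi).
  by apply: PolyMul => //; exact: PolyEntry.
have pA : poly_fun (fun psi : mx => psi a k * F psi).
  by apply: PolyMul => //; exact: PolyEntry.
have e0 b : E (fun psi : mx => psi b k * F' b a psi) + E (fun psi : mx => psi a k * F psi) = 0.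
  rewrite -(derivation_expectation0 b a (DerMul (DerEntry _ b k) dF)).
  rewrite -(EpolyD hPsi (pB b) pA); congr cexpectation; apply/funext => w.
  by rewrite eqxx mul1r.
rewrite (EpolyZ hPsi _ pA) -(Epoly_eq hPsi FH)
  (Epoly_sum hPsi (index_enum 'I_d) predT pB).
apply/eqP; rewrite -addr_eq0 addrC mulr_natl -[X in _ *+ X]card_ord -sumr_const.
by rewrite -big_split /=; apply/eqP; apply: big1.
Qed.

End SchwingerDyson.

(** * Wick products of gamma terms *)

Section SchwingerDysonCalculus.
Context (R : realType) (d : nat) (a k : 'I_d).
Local Notation C := R[i].
Local Notation mx := 'M[C]_d.

(** Hides the derivations and compares on unitary matrices only, where orthonormality of the columns
    collapses the sum produced by a conjugated entry. *)
Definition sd_pair (F H : mx -> C) : Prop :=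
  exists2 F', has_derivations F F' &
    forall psi, psi \is unitarymx -> \sum_b psi b k * F' b a psi = H psi.

Lemma sd_pair_eq (F1 F2 H1 H2 : mx -> C) : F1 =1 F2 ->
  (forall psi, psi \is unitarymx -> H1 psi = H2 psi) ->
  sd_pair F1 H1 -> sd_pair F2 H2.
Proof.
by move=> /funext <- e [F' dF h]; exists F' => // psi u; rewrite h // e.
Qed.

Lemma sd_cst c : sd_pair (fun _ => c) (fun _ => 0).
Proof.
exists (fun _ _ _ => 0); first exact: DerCst.
by move=> psi _; rewrite big1 // => b _; rewrite mulr0.
Qed.

Lemma sd_entry j l :
  sd_pair (fun psi => psi j l) (fun psi => psi a l * psi j k).
Proof.
eexists; first exact: DerEntry.
move=> psi _ /=; rewrite (bigD1 j) //= eqxx mul1r big1 ?addr0 1?mulrC //.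
by move=> b bj; rewrite eq_sym (negPf bj) mul0r mulr0.
Qed.

Lemma sd_conj j l :
  sd_pair (fun psi => (psi j l)^*) (fun _ => - ((j == a) && (k == l))%:R).
Proof.
eexists; first exact: DerConj.
move=> psi u /=; under eq_bigr do rewrite mulNr mulrN mulrCA.
by rewrite sumrN -mulr_sumr unitary_adjoint // -natrM mulnb.
Qed.

Lemma sd_add F G H K : sd_pair F H -> sd_pair G K ->
  sd_pair (fun psi => F psi + G psi) (fun psi => H psi + K psi).
Proof.
move=> [F' dF hF] [G' dG hG]; eexists; first exact: (DerAdd dF dG).
move=> psi u /=; rewrite -hF // -hG // -big_split.
by apply: eq_bigr => b _; rewrite mulrDr.
Qed.

Lemma sd_mul F G H K : sd_pair F H -> sd_pair G K ->
  sd_pair (fun psi => F psi * G psi) (fun psi => F psi * K psi + H psi * G psi).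
Proof.
move=> [F' dF hF] [G' dG hG]; eexists; first exact: (DerMul dF dG).
move=> psi u /=; rewrite -hF // -hG // mulr_sumr mulr_suml -big_split.
by apply: eq_bigr => b _ /=; ring.
Qed.

Lemma sd_scale c F H : sd_pair F H ->
  sd_pair (fun psi => c * F psi) (fun psi => c * H psi).
Proof.
move=> FH; apply: sd_pair_eq (sd_mul (sd_cst c) FH) => // psi _ /=.
by rewrite mul0r addr0.
Qed.

Lemma sd_sum (I : Type) (s : seq I) (Q : pred I) (F H : I -> mx -> C) :
  (forall i, Q i -> sd_pair (F i) (H i)) ->
  sd_pair (fun psi => \sum_(i <- s | Q i) F i psi)
          (fun psi => \sum_(i <- s | Q i) H i psi).
Proof.
move=> FH; elim: s => [|i s IH].
  by apply: sd_pair_eq (sd_cst 0) => psi; rewrite big_nil.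
case Qi : (Q i); last first.
  by apply: sd_pair_eq IH => psi; rewrite big_cons Qi.
by apply: sd_pair_eq (sd_add (FH i Qi) IH) => psi; rewrite big_cons Qi.
Qed.

End SchwingerDysonCalculus.

Fixpoint picks (X : Type) (s : seq X) : seq (X * seq X) :=
  if s is x :: s' then (x, s') :: [seq (f.1, x :: f.2) | f <- picks s'] else [::].

Lemma picks_perm (X : eqType) (s : seq X) f :
  f \in picks s -> perm_eq (f.1 :: f.2) s.
Proof.
elim: s f => [|x s IH] //= f; rewrite inE => /predU1P[-> //=|].
move=> /mapP[g /IH gs ->] /=.
by rewrite (perm_catCA [:: g.1] [:: x]) /= perm_cons.
Qed.

Lemma picks_subseq (X : eqType) (s : seq X) f : f \in picks s -> subseq f.2 s.
Proof.
elim: s f => [|x s IH] //= f; rewrite inE => /predU1P[->|] /=.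
  exact: subseq_cons.
by move=> /mapP[g /IH gs ->] /=; rewrite eqxx.
Qed.

Lemma size_picks (X : Type) (s : seq X) : size (picks s) = size s.
Proof. by elim: s => //= x s IH; rewrite size_map IH. Qed.

Section Wick.
Context (R : realType) (d p : nat) (col : 'I_p * bool -> 'I_d)
  (J : 'I_p -> 'I_d).
Local Notation C := R[i].
Local Notation mx := 'M[C]_d.
Local Notation label := ('I_p * bool)%type.
Implicit Types (e f : 'I_p * 'I_d) (g : label) (A : seq ('I_p * 'I_d))
  (B : {set label}).

(** A plain factor is a term with an explicit column because swaps change its column; conjugated
    factors are only ever removed, so labels with a fixed [col] suffice for them. *)
Definition internal e g : bool := (e.1 == g.1) && (e.2 == col g).

Definition external e g : bool :=
  [&& e.1 != g.1, J g.1 == J e.1 & e.2 == col g].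

(* The list [A] carries the factors [psi (J i) k] of the [i]-th gamma term, for
   [(i, k)] in [A]; the set [B] carries labels of conjugated factors.  Only
   pairings inside one gamma term are subtracted. *)
Fixpoint wick A B (psi : mx) : C :=
  if A is e :: A' then
    psi (J e.1) e.2 * wick A' B psi
      - d%:R^-1 * \sum_(g in B | internal e g) wick A' (B :\ g)%SET psi
  else \prod_(g in B) (psi (J g.1) (col g))^*.

Lemma wick_poly A B : poly_fun (wick A B).
Proof.
elim: A B => [|e A IH] B /=.
  by apply: poly_prod => g; exact: PolyConj.
apply: PolyAdd; first by apply: PolyMul => //; exact: PolyEntry.
by apply/poly_opp/PolyMul; [exact: PolyCst | exact: poly_sum].
Qed.

Lemma setD1_comm (T : finType) (B : {set T}) (x y : T) :
  ((B :\ x) :\ y = (B :\ y) :\ x)%SET.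
Proof. by rewrite !finset.setDDl finset.setUC. Qed.

Lemma sum_setD1 (T : finType) (B : {set T}) (x : T) (Q : pred T) (F : T -> C) :
  x \in B -> \sum_(y in B | Q y) F y =
    (if Q x then F x else 0) + \sum_(y in (B :\ x)%SET | Q y) F y.
Proof.
move=> xB; rewrite (big_mkcondr _ _ (fun y => y \in B)) (big_setD1 x) //=.
by rewrite -(big_mkcondr _ _ (fun y => y \in (B :\ x)%SET)).
Qed.

Lemma exchange_setD1 (T : finType) (B : {set T}) (P Q : pred T)
    (F : {set T} -> C) :
  \sum_(x in B | P x) \sum_(y in (B :\ x)%SET | Q y) F ((B :\ x) :\ y)%SET =
  \sum_(y in B | Q y) \sum_(x in (B :\ y)%SET | P x) F ((B :\ y) :\ x)%SET.
Proof.
rewrite (exchange_big_dep (fun y => (y \in B) && Q y)) /=; last first.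
  by move=> x y _; rewrite !inE => /andP[/andP[_ ->] ->].
apply: eq_bigr => y /andP[yB Qy]; apply: eq_big => [x|x _].
  by rewrite !inE yB Qy !andbT eq_sym; case: (x == y); rewrite ?andbF ?andbT.
by rewrite setD1_comm.
Qed.

(** Corrections that pair a factor no longer contain it, so the generator acts through that factor
    only where it is unpaired. Its two swapped images therefore stand outside the remaining Wick
    product. *)
Lemma sd_wick (a k : 'I_d) A B :
  sd_pair a k (wick A B) (fun psi =>
    \sum_(f <- picks A) psi a f.1.2 * psi (J f.1.1) k * wick f.2 B psi
    - \sum_(g in B | (J g.1 == a) && (k == col g)) wick A (B :\ g)%SET psi).
Proof.
elim: A B => [|e A IH] B /=.
  have [n] := ubnP #|B|; elim: n B => // n IHn B Bn.
  have [->|[g gB]] := set_0Vmem B.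
    apply: sd_pair_eq (sd_cst _ _ 1) => psi => [|_]; first by rewrite big_set0.
    by rewrite big_nil big_pred0 ?subr0 // => g; rewrite inE.
  have Bg : (#|B :\ g| < n)%N by rewrite [#|B|](cardsD1 g) gB in Bn.
  apply: sd_pair_eq (sd_mul (sd_conj R a k (J g.1) (col g)) (IHn _ Bg)) => psi => [|_].
    by rewrite [RHS](big_setD1 g).
  rewrite !big_nil !sub0r /= mulrN mulNr -opprD; congr (- _).
  rewrite [RHS](sum_setD1 _ _ gB) addrC; congr (_ + _).
    by case: ifP; rewrite ?mul1r ?mul0r.
  rewrite mulr_sumr; apply: eq_big => // h.
  rewrite !inE -andbA => /and3P[hg hB _].
  have gBh : g \in (B :\ h)%SET by rewrite !inE eq_sym hg gB.
  by rewrite [RHS](big_setD1 g gBh) /= setD1_comm.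
have base := sd_mul (sd_entry R a k (J e.1) e.2) (IH B).
have corr := sd_scale (- d%:R^-1) (sd_sum (index_enum _)
   (fun g _ => IH (B :\ g)%SET) (Q := fun g => (g \in B) && internal e g)).
apply: sd_pair_eq (sd_add base corr) => psi => [|_] /=; first by rewrite mulNr.
rewrite big_cons /= big_map /=.
pose c (f : 'I_p * 'I_d * seq ('I_p * 'I_d)) := psi a f.1.2 * psi (J f.1.1) k.
have -> : \sum_(f <- picks A) psi a f.1.2 * psi (J f.1.1) k *
    (psi (J e.1) e.2 * wick f.2 B psi -
      d%:R^-1 * \sum_(g in B | internal e g) wick f.2 (B :\ g)%SET psi) =
    psi (J e.1) e.2 * (\sum_(f <- picks A) c f * wick f.2 B psi) -
    d%:R^-1 * \sum_(g in B | internal e g)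
      \sum_(f <- picks A) c f * wick f.2 (B :\ g)%SET psi.
  rewrite [in RHS]exchange_big !mulr_sumr -sumrB; apply: eq_bigr => f _ /=.
  by rewrite -mulr_sumr /c; ring.
have -> : \sum_(g in B | (J g.1 == a) && (k == col g))
    (psi (J e.1) e.2 * wick A (B :\ g)%SET psi -
      d%:R^-1 * \sum_(h in (B :\ g)%SET | internal e h)
        wick A ((B :\ g) :\ h)%SET psi) =
    psi (J e.1) e.2 *
      (\sum_(g in B | (J g.1 == a) && (k == col g)) wick A (B :\ g)%SET psi) -
    d%:R^-1 * \sum_(h in B | internal e h)
      \sum_(g in (B :\ h)%SET | (J g.1 == a) && (k == col g))
        wick A ((B :\ h) :\ g)%SET psi.
  rewrite (exchange_setD1 B (internal e)
    (fun g => (J g.1 == a) && (k == col g)) (fun B' => wick A B' psi)).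
  by rewrite !mulr_sumr -sumrB.
rewrite sumrB /c; ring.
Qed.

End Wick.

(** * The recursion for expectations of Wick products *)

Section WickRecursion.
Context (R : realType) (d p : nat) (disp : measure_display)
  (T : measurableType disp) (P : probability T R) (Psi : T -> 'M[R[i]]_d)
  (hPsi : haar_unitary P Psi) (d_gt0 : (0 < d)%N)
  (col : 'I_p * bool -> 'I_d) (J : 'I_p -> 'I_d).
Local Notation C := R[i].
Local Notation mx := 'M[C]_d.
Local Notation label := ('I_p * bool)%type.
Local Notation wick := (@wick R d p col J).
Local Notation internal := (internal col).
Local Notation external := (external col J).
Local Notation E F := (cexpectation P (fun w => F (Psi w))).
Local Notation EW A B := (cexpectation P (fun w => wick A B (Psi w))).
Implicit Types (e f x y : 'I_p * 'I_d) (g : label) (A : seq ('I_p * 'I_d))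
  (B : {set label}).

Lemma wick_consE e A B (psi : mx) :
  psi (J e.1) e.2 * wick A B psi = wick (e :: A) B psi +
    d%:R^-1 * \sum_(g in B | internal e g) wick A (B :\ g)%SET psi.
Proof. by rewrite /= subrK. Qed.

(** Two ordinary factors absorbed back into the Wick product: neither, one or both are paired
    internally, with weight 1/d per pair. *)
Definition two_edges x y A B : C :=
  EW (x :: y :: A) B
  + d%:R^-1 * (\sum_(g in B | internal x g) EW (y :: A) (B :\ g)%SET)
  + d%:R^-1 * (\sum_(g in B | internal y g)
      (EW (x :: A) (B :\ g)%SET
       + d%:R^-1 * \sum_(h in (B :\ g)%SET | internal x h)
           EW A ((B :\ g) :\ h)%SET)).

Lemma expectation_two_edges x y A B :
  E (fun psi : mx => psi (J x.1) x.2 * psi (J y.1) y.2 * wick A B psi) =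
  two_edges x y A B.
Proof.
have pw : forall A B, poly_fun (wick A B) by exact: wick_poly.
have ps (I : Type) (s : seq I) (Q : pred I) AA BB :
    poly_fun (fun psi : mx => d%:R^-1 * \sum_(i <- s | Q i) wick AA (BB i) psi).
  by apply: PolyMul; [exact: PolyCst | apply: poly_sum].
have Ecorr AA (BB : {set label}) z : E (fun psi : mx => d%:R^-1 *
      \sum_(g in BB | internal z g) wick AA (BB :\ g)%SET psi) =
    d%:R^-1 * \sum_(g in BB | internal z g) EW AA (BB :\ g)%SET.
  rewrite (EpolyZ hPsi d%:R^-1 (poly_sum _ _ (fun g => pw AA (BB :\ g)%SET))).
  by rewrite (Epoly_sum hPsi _ _ (fun g => pw AA (BB :\ g)%SET)).
have Econs z AA (BB : {set label}) : E (fun psi : mx => psi (J z.1) z.2 * wick AA BB psi) =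
    EW (z :: AA) BB + d%:R^-1 * \sum_(g in BB | internal z g) EW AA (BB :\ g)%SET.
  rewrite -Ecorr -(EpolyD hPsi (pw _ _) (ps _ _ _ _ _)).
  by congr cexpectation; apply/funext => w; rewrite wick_consE.
pose G (psi : mx) := \sum_(g in B | internal y g)
   psi (J x.1) x.2 * wick A (B :\ g)%SET psi.
have pg g : poly_fun (fun psi : mx => psi (J x.1) x.2 * wick A (B :\ g)%SET psi).
  by apply: PolyMul => //; exact: PolyEntry.
have pG : poly_fun G by exact: poly_sum.
have pdG : poly_fun (fun psi : mx => d%:R^-1 * G psi).
  by apply: PolyMul => //; exact: PolyCst.
have -> : E (fun psi : mx => psi (J x.1) x.2 * psi (J y.1) y.2 * wick A B psi) =
    E (fun psi : mx => psi (J x.1) x.2 * wick (y :: A) B psi + d%:R^-1 * G psi).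
  congr cexpectation; apply/funext => w; rewrite -mulrA wick_consE mulrDr.
  by rewrite mulrCA mulr_sumr.
have px : poly_fun (fun psi : mx => psi (J x.1) x.2 * wick (y :: A) B psi).
  by apply: PolyMul => //; exact: PolyEntry.
rewrite (EpolyD hPsi px pdG).
rewrite Econs (EpolyZ hPsi _ pG) (Epoly_sum hPsi _ _ pg).
rewrite /two_edges; congr (_ + _ * _); apply: eq_bigr => g _; exact: Econs.
Qed.

Lemma wick_recursion e A B :
  EW (e :: A) B = d%:R^-1 *
    (\sum_(g in B | external e g) EW A (B :\ g)%SET
     - \sum_(f <- picks A) two_edges (e.1, f.1.2) (f.1.1, e.2) f.2 B).
Proof.
have pw : forall A B, poly_fun (wick A B) by exact: wick_poly.
have d0 : d%:R != 0 :> C by rewrite pnatr_eq0 -lt0n.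
have [F' dF FH] := sd_wick R col J (J e.1) e.2 A B.
have := schwinger_dyson hPsi dF FH.
have pA : poly_fun (fun psi : mx => psi (J e.1) e.2 * wick A B psi).
  by apply: PolyMul => //; exact: PolyEntry.
have pp (f : 'I_p * 'I_d * seq ('I_p * 'I_d)) : poly_fun (fun psi : mx =>
    psi (J e.1) f.1.2 * psi (J f.1.1) e.2 * wick f.2 B psi).
  by apply: PolyMul => //; apply: PolyMul; exact: PolyEntry.
rewrite (EpolyZ hPsi _ pA).
rewrite (EpolyB hPsi (poly_sum _ _ pp) (poly_sum _ _ (fun g => pw A (B :\ g)%SET))).
rewrite (Epoly_sum hPsi _ _ pp) (Epoly_sum hPsi _ _ (fun g => pw A (B :\ g)%SET)).
rewrite opprB => /(congr1 (fun z => d%:R^-1 * z)); rewrite mulKf // => h.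
have pc : poly_fun (fun psi : mx => d%:R^-1 *
    \sum_(g in B | internal e g) wick A (B :\ g)%SET psi).
  by apply: PolyMul; [exact: PolyCst | exact: poly_sum].
rewrite /= (EpolyB hPsi pA pc) h.
rewrite (EpolyZ hPsi _ (poly_sum _ _ (fun g => pw A (B :\ g)%SET))).
rewrite (Epoly_sum hPsi _ _ (fun g => pw A (B :\ g)%SET)).
rewrite -mulrBr; congr (_ * _); rewrite addrAC; congr (_ - _); last first.
  by apply: eq_bigr => f _; rewrite -expectation_two_edges.
(* The conjugates hit by the generator split into internal and external ones; the internal part is
   exactly the Wick correction of [e], with the same weight 1/d, and cancels. *)
rewrite (bigID (fun g => internal e g)) /= addrAC.
rewrite [X in X - _](eq_bigl (fun g => (g \in B) && internal e g)) => [|g].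
  rewrite subrr add0r; apply: eq_bigl => g.
  rewrite /external /internal eq_sym; case: (e.1 =P g.1) => [->|_] //=.
    by rewrite eqxx; case: (_ == _); rewrite ?andbF.
  by rewrite andbT.
rewrite /internal; case: (e.1 =P g.1) => [->|_]; last by rewrite !andbF.
by rewrite eqxx /=; case: (_ == _); rewrite ?andbF ?andbT.
Qed.

(** Each plain factor contributes either itself or one of at most N internal pairs of weight at most
    1. *)
Lemma wick_norm_le A B N (psi : mx) : psi \is unitarymx -> (#|B| <= N)%N ->
  `|wick A B psi| <= N.+1%:R ^+ size A.
Proof.
move=> u; elim: A B => [|e A IH] B BN /=.
  rewrite normr_prod; apply: prodr_ile1 => g _.
  by rewrite normr_ge0 norm_conjC unitary_entry_le1.
have wN : N.+1%:R ^+ size A >= 0 :> C by rewrite exprn_ge0.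
apply: le_trans (ler_normB _ _) _.
have IHB := IH B BN; rewrite exprS; set X := _ ^+ size A in wN IHB *.
rewrite -natr1 mulrDl mul1r addrC; apply: lerD; last first.
  by rewrite normrM -[leRHS]mul1r; apply: ler_pM; rewrite ?unitary_entry_le1.
rewrite normrM -[leRHS]mul1r; apply: ler_pM => //.
  by rewrite normfV normr_nat invf_le1 ?ltr0n // ler1n.
apply: le_trans (ler_norm_sum _ _ _) _.
apply: (@le_trans _ _ (\sum_(g in B | internal e g) X)).
  apply: ler_sum => g /andP[gB _]; apply: IH.
  by apply: leq_trans BN; rewrite [leqRHS](cardsD1 g) gB leq_addl.
rewrite sumr_const -[leLHS]mulr_natl ler_wpM2r // ler_nat.
apply: leq_trans BN; apply: subset_leq_card; apply/fintype.subsetP => g.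
by rewrite unfold_in => /andP[].
Qed.

End WickRecursion.

(** * Exponents of configurations and their change along the recursion *)

Section Exponent.
Context (d p : nat) (col : 'I_p * bool -> 'I_d) (J : 'I_p -> 'I_d).
Local Notation label := ('I_p * bool)%type.
Local Notation internal := (internal col).
Local Notation external := (external col J).
Implicit Types (e f x y : 'I_p * 'I_d) (g : label) (A : seq ('I_p * 'I_d))
  (B : {set label}).
Local Open Scope nat_scope.

(** The number x, computed along the list so that the effect of adding or removing one factor is
    immediate; [matching_number_attained] recovers an actual set of pairs. *)
Fixpoint matching_number A B : nat :=
  if A is e :: A' then
    maxn (matching_number A' B)
      (\max_(g in B | external e g) (matching_number A' (B :\ g)%SET).+1)
  else 0.

Local Notation xs := matching_number.

Lemma matching_number_subset A B B' : B \subset B' -> xs A B <= xs A B'.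
Proof.
elim: A B B' => [|e A IH] B B' BB //=; rewrite geq_max; apply/andP; split.
  by apply: leq_trans (IH _ _ BB) _; exact: leq_maxl.
apply/bigmax_leqP => g /andP[gB eg]; apply: leq_trans _ (leq_maxr _ _).
have gB' : (g \in B') && external e g by rewrite (fintype.subsetP BB).
by apply: (bigop.bigmax_sup g gB'); rewrite ltnS; exact/IH/finset.setSD.
Qed.

Lemma matching_number_subseq A A' B : subseq A A' -> xs A B <= xs A' B.
Proof.
elim: A' A B => [|e A' IH] [|f A] B //=.
case: eqP => [->|_] s.
  rewrite geq_max; apply/andP; split.
    by apply: leq_trans (IH _ _ s) _; exact: leq_maxl.
  apply/bigmax_leqP => g h; apply: leq_trans _ (leq_maxr _ _).
  by apply: (bigop.bigmax_sup g h); rewrite ltnS; exact: IH.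
by apply: leq_trans (leq_maxl _ _); apply: (IH (f :: A)).
Qed.

Lemma matching_number_cons e A B : xs (e :: A) B <= (xs A B).+1.
Proof.
rewrite /= geq_max leqnSn; apply/bigmax_leqP => g _.
by rewrite ltnS matching_number_subset // finset.subD1set.
Qed.

Lemma matching_number_size A B : xs A B <= size A.
Proof. by elim: A => //= e A IH; apply: leq_trans (matching_number_cons _ _ _) _. Qed.

Lemma matching_number_external e A B g : g \in B -> external e g ->
  xs A (B :\ g)%SET < xs (e :: A) B.
Proof.
move=> gB eg; apply: leq_trans (leq_maxr _ _).
by apply: (bigop.bigmax_sup g); rewrite ?gB.
Qed.

(** The condition under which all plain factors can be matched with conjugated ones of the same
    column, hence partial matchings completed to coverings. *)
Definition balanced A B : bool :=
  [forall k, count (fun e => e.2 == k) A == #|[set g in B | col g == k]%SET|].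

Lemma balanced_remove e A B g : g \in B -> e.2 = col g ->
  balanced (e :: A) B = balanced A (B :\ g)%SET.
Proof.
move=> gB eg; apply: eq_forallb => k /=.
rewrite [X in _ == X](cardsD1 g) !inE gB eg /= eqn_add2l.
congr (_ == #|pred_of_set _|); apply/setP => h.
by rewrite !inE andbA.
Qed.

Lemma balanced_perm A A' B : perm_eq [seq e.2 | e <- A] [seq e.2 | e <- A'] ->
  balanced A B = balanced A' B.
Proof.
move=> AA; apply: eq_forallb => k; congr (_ == _).
by have /permP/(_ (fun l => l == k)) := AA; rewrite !count_map.
Qed.

(* The exponent of [d^(-1/4)]; [r] truncates it, and unbalanced configurations,
   whose expectation vanishes, reach any truncation. *)
Definition exponent r A B : nat :=
  if balanced A B then minn r (6 * size A - 2 * xs A B) else r.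

Local Notation ex := exponent.

(** If the new configuration is unbalanced or truncated, the right side is [r + c], which already
    reaches the cap [r.+1]; only the untruncated balanced case uses the numerical hypothesis. *)
Lemma exponent_compare r A B A' B' c : 0 < c ->
  (balanced A' B' -> balanced A B) ->
  6 * size A + 2 * xs A' B' <= 6 * size A' + c + 2 * xs A B ->
  ex r.+1 A B <= ex r A' B' + c.
Proof.
move=> c0 bb h; rewrite /exponent.
have := matching_number_size A B; have := matching_number_size A' B'.
case: (boolP (balanced A' B')) => [/bb ->|_]; last by case: ifP => _; lia.
by lia.
Qed.

Let size_cons e A : size (e :: A) = (size A).+1.
Proof. by []. Qed.

(** Losing a plain factor costs 6 and losing an external pair gives back 2; the net 4 quarter powers
    are the 1/d of the recursion. *)
Lemma exponent_external r e A B g : g \in B -> external e g ->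
  ex r.+1 (e :: A) B <= ex r A (B :\ g)%SET + 4.
Proof.
move=> gB eg; have := matching_number_external A gB eg => h.
apply: exponent_compare => //; last by rewrite size_cons; lia.
by rewrite (balanced_remove _ gB) //; case/and3P: eg => _ _ /eqP.
Qed.

Section Swap.
Context (r : nat) (e : 'I_p * 'I_d) (A : seq ('I_p * 'I_d)) (B : {set label})
  (f : ('I_p * 'I_d) * seq ('I_p * 'I_d)) (fA : f \in picks A).
Let x := (e.1, f.1.2).
Let y := (f.1.1, e.2).

Let size_fA : size A = (size f.2).+1.
Proof. by have /perm_size := picks_perm fA. Qed.

Let xs_fA B' : xs f.2 B' <= xs (e :: A) B'.
Proof.
apply: leq_trans (leq_maxl _ _).
by apply: matching_number_subseq; exact: picks_subseq.
Qed.

Let bal_fA : balanced (x :: y :: f.2) B = balanced (e :: A) B.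
Proof.
apply: balanced_perm => /=.
rewrite (perm_catCA [:: _] [:: _]) /= perm_cons -map_cons.
apply: perm_map; exact: picks_perm.
Qed.

Let bal_fA' : balanced (y :: x :: f.2) B = balanced (e :: A) B.
Proof.
rewrite -bal_fA; apply: balanced_perm => /=.
by rewrite (perm_catCA [:: _] [:: _]).
Qed.

(** The length is unchanged and the two new factors form at most two external pairs, worth 2
    each. *)
Lemma exponent_swap : ex r.+1 (e :: A) B <= ex r (x :: y :: f.2) B + 4.
Proof.
apply: exponent_compare => //; first by rewrite bal_fA.
have := matching_number_cons x (y :: f.2) B.
have := matching_number_cons y f.2 B.
have := xs_fA B; rewrite !size_cons size_fA; lia.
Qed.

(** One factor lost (6) and at most one external pair created (2): the 8 of 1/d^2. *)
Lemma exponent_internal1 g : g \in B -> internal x g ->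
  ex r.+1 (e :: A) B <= ex r (y :: f.2) (B :\ g)%SET + 8.
Proof.
move=> gB /andP[_ /eqP xg]; apply: exponent_compare => //.
  by rewrite -(balanced_remove _ gB xg) bal_fA.
have : xs (y :: f.2) (B :\ g)%SET <= (xs (e :: A) B).+1.
  apply: leq_trans (matching_number_cons _ _ _) _; rewrite ltnS.
  exact: leq_trans (matching_number_subset f.2 (finset.subD1set B g)) (xs_fA B).
rewrite !size_cons size_fA; lia.
Qed.

Lemma exponent_internal2 g : g \in B -> internal y g ->
  ex r.+1 (e :: A) B <= ex r (x :: f.2) (B :\ g)%SET + 8.
Proof.
move=> gB /andP[_ /eqP yg]; apply: exponent_compare => //.
  by rewrite -(balanced_remove _ gB yg) bal_fA'.
have : xs (x :: f.2) (B :\ g)%SET <= (xs (e :: A) B).+1.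
  apply: leq_trans (matching_number_cons _ _ _) _; rewrite ltnS.
  exact: leq_trans (matching_number_subset f.2 (finset.subD1set B g)) (xs_fA B).
rewrite !size_cons size_fA; lia.
Qed.

(** Two factors lost and no new pair possible: the 12 of 1/d^3. *)
Lemma exponent_internal3 g h : g \in B -> internal y g ->
  h \in (B :\ g)%SET -> internal x h ->
  ex r.+1 (e :: A) B <= ex r f.2 ((B :\ g) :\ h)%SET + 12.
Proof.
move=> gB /andP[_ /eqP yg] hB /andP[_ /eqP xh]; apply: exponent_compare => //.
  by rewrite -(balanced_remove _ hB xh) -(balanced_remove _ gB yg) bal_fA'.
have : xs f.2 ((B :\ g) :\ h)%SET <= xs (e :: A) B.
  apply: leq_trans (matching_number_subset f.2 (finset.subD1set _ _)) _.
  exact: leq_trans (matching_number_subset f.2 (finset.subD1set B g)) (xs_fA B).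
rewrite !size_cons size_fA; lia.
Qed.

End Swap.
End Exponent.

(** * Iterating the recursion *)

Section MomentBound.
Context (R : realType) (d p : nat) (disp : measure_display)
  (T : measurableType disp) (P : probability T R) (Psi : T -> 'M[R[i]]_d)
  (hPsi : haar_unitary P Psi) (d_gt0 : (0 < d)%N)
  (col : 'I_p * bool -> 'I_d) (J : 'I_p -> 'I_d).
Local Notation C := R[i].
Context (u : C) (u_ge0 : 0 <= u) (u_le1 : u <= 1) (u4 : u ^+ 4 = d%:R^-1).
Local Notation label := ('I_p * bool)%type.
Local Notation EW A B := (cexpectation P (fun w => wick col J A B (Psi w))).
Local Notation ex := (exponent col J).
Implicit Types (A : seq ('I_p * 'I_d)) (B : {set label}).

(** The first factors come from the trivial bound at r = 0. One step yields at most N external terms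
    and N swaps, each swap giving 1 + N + N (1 + N) = (1 + N)^2 terms; [N.+1] in place of N keeps
    the constant positive. *)
Definition moment_constant (N r : nat) : nat :=
  2 * N.+1 ^ N * (N.+1 * (1 + N.+1 ^ 2)) ^ r.

Lemma sum_subset_le (N : nat) B (Q : pred label) (F : label -> C) (M : C) :
  0 <= M -> (#|B| <= N)%N -> (forall g, g \in B -> Q g -> `|F g| <= M) ->
  `|\sum_(g in B | Q g) F g| <= N%:R * M.
Proof.
move=> M0 BN FM; apply: le_trans (ler_norm_sum _ _ _) _.
apply: (@le_trans _ _ (\sum_(g in B | Q g) M)).
  by apply: ler_sum => g /andP[gB Qg]; exact: FM.
rewrite sumr_const -[leLHS]mulr_natl ler_wpM2r // ler_nat.
apply: leq_trans BN; apply: subset_leq_card; apply/fintype.subsetP => g.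
by rewrite unfold_in => /andP[].
Qed.

Lemma u_pow_le (m n : nat) : (m <= n)%N -> u ^+ n <= u ^+ m.
Proof. by move=> mn; apply: ler_wiXn2l. Qed.

Lemma moment_bound N r A B : (size A <= N)%N -> size A = #|B| ->
  `|EW A B| <= (moment_constant N r)%:R * u ^+ ex r A B.
Proof.
elim: r A B => [|r IH] A B AN AB.
  have -> : ex 0 A B = 0%N by rewrite /exponent min0n if_same.
  rewrite expr0 mulr1 /moment_constant expn0 muln1 natrM.
  apply: Epoly_norm_le => // [|psi upsi]; first exact: wick_poly.
  have BN : (#|B| <= N)%N by rewrite -AB.
  apply: le_trans (wick_norm_le d_gt0 col J A upsi BN) _.
  by rewrite natrX ler_weXn2l // ler1n.
case: A AN AB => [|e A] /= AN AB.
  have B0 : B = finset.set0 by apply/eqP; rewrite -cards_eq0 -AB.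
  have -> : EW [::] B = 1.
    rewrite -[RHS](cexpectation_cst P); congr cexpectation; apply/funext => w.
    by rewrite /= B0 big_set0.
  (* Equality of sizes matters here: it makes the terminal configuration balanced, so that its
     exponent is 0 and not the truncation level. *)
  have -> : ex r.+1 [::] B = 0%N.
    rewrite /exponent; case: ifP => [_|/negP[]]; first by rewrite minn0.
    apply/forallP => k /=; rewrite B0 eq_sym cards_eq0; apply/eqP/setP => g.
    by rewrite !inE.
  rewrite expr0 mulr1 normr1 ler1n /moment_constant.
  by rewrite !muln_gt0 !expn_gt0.
set X := u ^+ ex _ _ _; set K := (moment_constant N r)%:R : C.
have X0 : 0 <= X by rewrite exprn_ge0.
have K0 : 0 <= K by rewrite ler0n.
have KX0 : 0 <= K * X by exact: mulr_ge0.
(* The weight [u ^+ c] is supplied by the recursion: 4 from its prefactor 1/d and 4 for each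
   internal pair. *)
have step c A' B' : (size A' <= N)%N -> size A' = #|B'| ->
    (ex r.+1 (e :: A) B <= ex r A' B' + c)%N -> `|u ^+ c * EW A' B'| <= K * X.
  move=> A'N A'B' h; rewrite normrM normrX (ger0_norm u_ge0).
  apply: le_trans (ler_wpM2l (exprn_ge0 c u_ge0) (IH _ _ A'N A'B')) _.
  by rewrite mulrCA -exprD; apply: ler_wpM2l => //; apply: u_pow_le; rewrite addnC.
have BN : (#|B| <= N)%N by rewrite -AB.
have cardD1 B' g : g \in B' -> #|(B' :\ g)%SET| = #|B'|.-1.
  by move=> gB; rewrite [#|B'|](cardsD1 g) gB.
rewrite (wick_recursion hPsi d_gt0) -u4 mulrBr.
have two_bound f : f \in picks A ->
    `|u ^+ 4 * two_edges P Psi col J (e.1, f.1.2) (f.1.1, e.2) f.2 B|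
      <= (1 + N%:R + N%:R * (1 + N%:R)) * (K * X).
  move=> fA; have sA : size A = (size f.2).+1.
    by have /perm_size := picks_perm fA.
  have sN : ((size f.2).+2 <= N)%N by rewrite -sA.
  have sB : #|B| = (size f.2).+2 by rewrite -AB sA.
  have -> (v w z : C) : u ^+ 4 * (v + d%:R^-1 * w + d%:R^-1 * z) =
      u ^+ 4 * v + u ^+ 8 * w + u ^+ 8 * z by rewrite -u4; ring.
  rewrite !mulr_sumr !mulrDl mul1r.
  apply: le_trans (ler_normD _ _) (lerD _ _); last first.
    rewrite -mulrA; apply: sum_subset_le => // [|g gB yg].
      by rewrite mulr_ge0 // addr_ge0 // ler0n.
    have -> (v w : C) : u ^+ 8 * (v + d%:R^-1 * w) = u ^+ 8 * v + u ^+ 12 * w.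
      by rewrite -u4; ring.
    rewrite mulrDl mul1r; apply: le_trans (ler_normD _ _) (lerD _ _).
      apply: step; [exact: ltnW | by rewrite cardD1 ?sB |].
      exact: exponent_internal2.
    rewrite mulr_sumr; apply: sum_subset_le => // [|h hB xh].
      by apply: leq_trans BN; rewrite cardD1 // leq_pred.
    apply: step; [by apply: leq_trans sN; exact: leqW | by rewrite !cardD1 ?sB |].
    exact: exponent_internal3.
  apply: le_trans (ler_normD _ _) (lerD _ _).
    by apply: step => //; exact: exponent_swap.
  apply: sum_subset_le => // g gB xg.
  apply: step; [exact: ltnW | by rewrite cardD1 ?sB |].
  exact: exponent_internal1.
apply: le_trans (ler_normB _ _) _.
have -> : (moment_constant N r.+1)%:R * X =
    (N.+1 * (1 + N.+1 ^ 2))%:R * (K * X).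
  by rewrite /K /moment_constant expnSr mulnA natrM; ring.
apply: (@le_trans _ _ (N%:R * (K * X) +
    N%:R * ((1 + N%:R + N%:R * (1 + N%:R)) * (K * X)))); last first.
  rewrite [leLHS](_ : _ =
    (N + N * (1 + N + N * (1 + N)))%N%:R * (K * X)); last first.
    by rewrite !(natrD, natrM); ring.
  apply: ler_wpM2r => //; rewrite ler_nat -mulnn; nia.
apply: lerD.
  rewrite mulr_sumr; apply: sum_subset_le => // g gB eg.
  apply: step; [exact: ltnW | by rewrite cardD1 // -AB |].
  exact: exponent_external.
rewrite mulr_sumr; apply: le_trans (ler_norm_sum _ _ _) _.
apply: (@le_trans _ _ (\sum_(f <- picks A) (1 + N%:R + N%:R * (1 + N%:R)) * (K * X))).
  by rewrite big_seq [leRHS]big_seq; apply: ler_sum => f; exact: two_bound.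
rewrite big_const_seq count_predT size_picks iter_addr_0 -[leLHS]mulr_natl.
apply: ler_wpM2r; last by rewrite ler_nat ltnW.
by rewrite mulr_ge0 // !addr_ge0 ?mulr_ge0 ?ler0n.
Qed.

End MomentBound.

(** * Gamma terms as sums of Wick products *)

Section GammaExpansion.
Context (R : realType) (d p : nat) (g : 'I_p -> gidx d).
Local Notation C := R[i].
Local Notation mx := 'M[C]_d.
Local Notation label := ('I_p * bool)%type.

(* The labels [(i, s)] index the two conjugated, resp. plain, factors of the
   [i]-th gamma term; [conj_column] and [plain_column] give their columns. *)
Definition conj_column (h : label) : 'I_d := column g (h.1, (true, h.2)).
Definition plain_column (h : label) : 'I_d := column g (h.1, (false, h.2)).

Definition plain_edges (s : seq 'I_p) : seq ('I_p * 'I_d) :=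
  flatten [seq [:: (i, plain_column (i, false)); (i, plain_column (i, true))] | i <- s].

(** The Wick product written out over the seven partial matchings of two plain with two conjugated
    factors: one empty, four single, two double, with alternating sign. *)
Definition gamma_wick (psi : mx) (i : 'I_p) (j : 'I_d) : C :=
  let k := conj_column (i, false) in let l := plain_column (i, false) in
  let m := conj_column (i, true) in let n := plain_column (i, true) in
  (psi j k)^* * psi j l * (psi j m)^* * psi j n
  - d%:R^-1 * (l == k)%:R * (psi j m)^* * psi j n
  - d%:R^-1 * (l == m)%:R * (psi j k)^* * psi j n
  - d%:R^-1 * (n == k)%:R * (psi j m)^* * psi j l
  - d%:R^-1 * (n == m)%:R * (psi j k)^* * psi j l
  + d%:R^-1 ^+ 2 * (l == k)%:R * (n == m)%:R
  + d%:R^-1 ^+ 2 * (l == m)%:R * (n == k)%:R.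

(* Unitarity turns each subtracted single pairing into the centering term of
   gamma; there are two for each of the two double pairings. *)
Lemma sum_gamma_wick (psi : mx) (i : 'I_p) : (0 < d)%N ->
  psi \is unitarymx -> \sum_j gamma_wick psi i j = gamma psi (g i).
Proof.
move=> d0 u; have dn0 : d%:R != 0 :> C by rewrite pnatr_eq0 -lt0n.
have orth c k l : \sum_j c * (psi j k)^* * psi j l = c * (l == k)%:R.
  rewrite -(unitary_adjoint l k u) mulr_sumr; apply: eq_bigr => j _; ring.
have cst (c : C) : \sum_(j < d) d%:R^-1 ^+ 2 * c = d%:R^-1 * c.
  by rewrite sumr_const card_ord -[LHS]mulr_natl; field.
rewrite /gamma_wick !big_split /= !sumrN !orth.
under [X in _ + X + _]eq_bigr do rewrite -mulrA.
under [X in _ + X]eq_bigr do rewrite -mulrA.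
rewrite !cst /conj_column /plain_column /column /gterm /=.
case: (g i) => [[[k l] m] n] /=.
rewrite ![l == _]eq_sym ![n == _]eq_sym; ring.
Qed.

Variable J : 'I_p -> 'I_d.
Local Notation wick := (@wick R d p conj_column J).

(** No correction ever removes [h], so its factor comes out of the whole recursion. *)
Lemma wick_free A (B : {set label}) (h : label) (psi : mx) : h \in B ->
  (forall e, e \in A -> ~~ internal conj_column e h) ->
  wick A B psi = (psi (J h.1) (conj_column h))^* * wick A (B :\ h)%SET psi.
Proof.
elim: A B => [|e A IH] B hB free /=; first by rewrite (big_setD1 h).
have freeA f : f \in A -> ~~ internal conj_column f h.
  by move=> fA; apply: free; rewrite inE fA orbT.
rewrite (IH B) // mulrBr mulrCA; congr (_ - _).
rewrite mulrCA; congr (_ * _); rewrite mulr_sumr.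
rewrite (sum_setD1 _ _ hB) (negPf (free e _)) ?mem_head // add0r.
apply: eq_bigr => x /andP[]; rewrite !inE => /andP[xh xB] _.
have hBx : h \in (B :\ x)%SET by rewrite !inE eq_sym xh hB.
by rewrite (IH _ hBx freeA) setD1_comm.
Qed.

Lemma sum_internal (i : 'I_p) (c : 'I_d) (B : {set label}) (F : label -> C) :
  \sum_(h in B | internal conj_column (i, c) h) F h =
    (((i, false) \in B) && (c == conj_column (i, false)))%:R * F (i, false) +
    (((i, true) \in B) && (c == conj_column (i, true)))%:R * F (i, true).
Proof.
have -> : \sum_(h in B | internal conj_column (i, c) h) F h = \sum_i' \sum_s
    (if ((i', s) \in B) && internal conj_column (i, c) (i', s) then F (i', s) else 0).
  by rewrite pair_bigA /= big_mkcond; apply: eq_bigr => -[i' s] _.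
rewrite (bigD1 i) //= [X in _ + X]big1 ?addr0 => [|i' ii']; last first.
  by rewrite big1 // => s _; rewrite /internal /= eq_sym (negPf ii') andbF.
rewrite big_bool /= addrC /internal /= eqxx /=.
by congr (_ + _); case: ifP => _; rewrite ?mul1r ?mul0r.
Qed.

Lemma wick_pair (i : 'I_p) A (B : {set label}) (psi : mx) :
  (i, false) \in B -> (i, true) \in B -> (forall e, e \in A -> e.1 != i) ->
  wick ((i, plain_column (i, false)) :: (i, plain_column (i, true)) :: A) B psi =
  gamma_wick psi i (J i) * wick A ((B :\ (i, false)) :\ (i, true))%SET psi.
Proof.
move=> aB bB free.
have free' s e : e \in A -> ~~ internal conj_column e (i, s).
  by move=> /free ei; rewrite /internal /= (negPf ei).
have ab : ((i, true) == (i, false)) = false by rewrite xpair_eqE andbF.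
have ba : ((i, false) == (i, true)) = false by rewrite xpair_eqE andbF.
rewrite /= !sum_internal !inE aB bB !eqxx ab ba /= !mul0r add0r addr0.
have aBb : (i, false) \in (B :\ (i, true))%SET by rewrite !inE aB ba.
have bBa : (i, true) \in (B :\ (i, false))%SET by rewrite !inE bB ab.
rewrite (wick_free psi aB (free' false)) (wick_free psi aBb (free' false)).
rewrite (wick_free psi bBa (free' true)) (setD1_comm B (i, true)) /=.
rewrite /gamma_wick.
set w := wick A _ psi; ring.
Qed.

Lemma wick_gamma (s : seq 'I_p) (psi : mx) : uniq s ->
  wick (plain_edges s) [set h | h.1 \in s]%SET psi =
  \prod_(i <- s) gamma_wick psi i (J i).
Proof.
elim: s => [_|i s IH]; last rewrite cons_uniq => /andP[iS us].
  by rewrite big_nil /= big_pred0 // => h; rewrite inE.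
rewrite big_cons -IH // -[plain_edges (i :: s)]/[:: _, _ & plain_edges s].
rewrite wick_pair ?inE ?eqxx //=; last first.
  move=> e /flattenP[_ /mapP[i' i's ->]]; rewrite !inE.
  by case/orP=> /eqP -> /=; apply: contraNneq iS => <-.
congr (_ * wick _ _ _); apply/setP => -[i' b]; rewrite !inE !xpair_eqE /=.
by case: (i' =P i) => [->|_] /=; [rewrite (negPf iS); case: b | ].
Qed.

End GammaExpansion.

Lemma prod_gamma (R : realType) (d p : nat) (g : 'I_p -> gidx d)
    (psi : 'M[R[i]]_d) : (0 < d)%N -> psi \is unitarymx ->
  \prod_(i < p) gamma psi (g i) =
  \sum_(J : {ffun 'I_p -> 'I_d})
    wick (conj_column g) J (plain_edges g (enum 'I_p)) finset.setT psi.
Proof.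
move=> d0 u; under eq_bigr do rewrite -sum_gamma_wick //.
rewrite bigA_distr_bigA; apply: eq_bigr => J _ /=.
rewrite -[RHS](congr1 (fun B => wick (conj_column g) J _ B psi)
  (_ : [set h | h.1 \in enum 'I_p]%SET = _)); last first.
  by apply/setP => h; rewrite !inE mem_enum.
by rewrite wick_gamma ?enum_uniq // big_enum.
Qed.

(** * Matchings and smart families *)

Section Matchings.
Local Open Scope set_scope.
Local Open Scope nat_scope.
Context (L D : finType) (pc cc : L -> D).
Implicit Types (M : {set L * L}) (X Y : {set L}).

Definition matching M : Prop :=
  [/\ {in M &, injective fst}, {in M &, injective snd} &
      forall x, x \in M -> pc x.1 = cc x.2].

Definition between X Y M : Prop :=
  forall x, x \in M -> x.1 \in X /\ x.2 \in Y.

Lemma matching_sub M M' : M \subset M' -> matching M' -> matching M.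
Proof.
move=> /fintype.subsetP s [h1 h2 h3]; split => [x y xM yM|x y xM yM|x xM].
- by apply: h1; exact: s.
- by apply: h2; exact: s.
- by apply: h3; exact: s.
Qed.

Lemma matching_add M e f : matching M -> pc e = cc f ->
  (forall x, x \in M -> x.1 <> e) -> (forall x, x \in M -> x.2 <> f) ->
  matching ((e, f) |: M).
Proof.
move=> [h1 h2 h3] ef eM fM; split => [x y|x y|x].
- rewrite !inE => /predU1P[-> | xM] /predU1P[-> // | yM] //=.
  + by move=> /esym /(eM _ yM).
  + by move=> /(eM _ xM).
  + exact: h1.
- rewrite !inE => /predU1P[-> | xM] /predU1P[-> // | yM] //=.
  + by move=> /esym /(fM _ yM).
  + by move=> /(fM _ xM).
  + exact: h2.
- by rewrite !inE => /predU1P[-> // | ]; exact: h3.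
Qed.

Lemma card_matching_le X Y M : matching M -> between X Y M -> #|M| <= #|X|.
Proof.
move=> [h1 _ _] b; rewrite -(card_in_imset h1); apply: subset_leq_card.
by apply/fintype.subsetP => _ /imsetP[x xM ->]; have [] := b x xM.
Qed.

(* If [e] is unmatched, then in its colour class fewer vertices are matched
   than there are on either side, so a partner of [e] is still free. *)
Lemma matching_extend X Y M :
  (forall c, #|[set e in X | pc e == c]| = #|[set f in Y | cc f == c]|) ->
  matching M -> between X Y M ->
  exists M', [/\ matching M', M \subset M', between X Y M' & #|M'| = #|X|].
Proof.
move=> bal; have [n] := ubnP (#|X| - #|M|); elim: n M => // n IH M Mn mM bM.
have := card_matching_le mM bM; rewrite leq_eqVlt => /predU1P[MX | MX].
  by exists M; split.
have [h1 h2 h3] := mM.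
have /subsetPn[e eX eM] : ~~ (X \subset fst @: M).
  by apply: contraL MX => /subset_leq_card; rewrite (card_in_imset h1) -leqNgt.
pose c := pc e; pose Mc := [set x in M | pc x.1 == c].
have McM : Mc \subset M by apply/fintype.subsetP => x; rewrite inE => /andP[].
have [hc1 hc2 _] := matching_sub McM mM.
have /subsetPn[f] : ~~ ([set f in Y | cc f == c] \subset snd @: Mc).
  apply/negP => /subset_leq_card; rewrite -bal (card_in_imset hc2).
  rewrite -(card_in_imset hc1) leqNgt => /negP; apply; apply: proper_card.
  apply/properP; split.
    apply/fintype.subsetP => _ /imsetP[x + ->]; rewrite !inE => /andP[xM ->].
    by have [-> _] := bM x xM.
  exists e; first by rewrite inE eX eqxx.
  by apply: contraNN eM => /imsetP[x xM ->]; rewrite imset_f // (fintype.subsetP McM).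
rewrite inE => /andP[fY /eqP fc] fM.
have eM' x : x \in M -> x.1 <> e.
  by move=> xM xe; case/negP: eM; rewrite -xe imset_f.
have fM' x : x \in M -> x.2 <> f.
  move=> xM xf; case/negP: fM; rewrite -xf imset_f // inE xM h3 // xf fc.
  exact: eqxx.
have mM' := matching_add mM (esym fc) eM' fM'.
have nM : (e, f) \notin M by apply/negP => /eM'.
have [||M' [k1 k2 k3 k4]] := IH _ _ mM'.
- by rewrite cardsU1 nM; move: Mn MX; lia.
- by move=> x /setU1P[-> //|/bM].
by exists M'; split => //; apply: fintype.subset_trans k2; exact: finset.subsetUr.
Qed.

End Matchings.

Section CrossingMatchings.
Context (d p : nat) (g : 'I_p -> gidx d) (J : 'I_p -> 'I_d).
Local Notation label := ('I_p * bool)%type.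
Local Open Scope set_scope.
Local Open Scope nat_scope.

Definition crossing (M : {set label * label}) : Prop :=
  forall x, x \in M -> x.1.1 != x.2.1 /\ J x.1.1 = J x.2.1.

(** A set of pairs, unlike the recursive number, can be split over the classes of equal
    j-indices. *)
Lemma matching_number_attained (s : seq label) (B : {set label}) : uniq s ->
  exists M, [/\ matching (plain_column g) (conj_column g) M, between [set h in s] B M, crossing M
    & #|M| = matching_number (conj_column g) J [seq (h.1, plain_column g h) | h <- s] B].
Proof.
elim: s B => [|e s IH] B /=.
  exists finset.set0; rewrite cards0; split => //.
  - by split => [x y|x y|x]; rewrite inE.
  - by move=> x; rewrite finset.in_set0.
  - by move=> x; rewrite finset.in_set0.
move=> /andP[es us].
set v := maxn _ _.
have : v = matching_number (conj_column g) J [seq (h.1, plain_column g h) | h <- s] B \/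
   exists2 f, (f \in B) && external (conj_column g) J (e.1, plain_column g e) f &
     v = (matching_number (conj_column g) J [seq (h.1, plain_column g h) | h <- s] (B :\ f)).+1.
  rewrite /v; set w := \max_(_ in _ | _) _.
  have [wn|wn] := leqP w (matching_number (conj_column g) J [seq (h.1, plain_column g h) | h <- s] B).
    by left.
  right; case: (pickP (fun f => (f \in B) && external (conj_column g) J (e.1, plain_column g e) f)).
    move=> f0 hf0.
    pose Q := [pred f | (f \in B) && external (conj_column g) J (e.1, plain_column g e) f].
    have Q0 : 0 < #|Q| by apply/card_gt0P; exists f0.
    have [f hf wf] := eq_bigmax_cond (fun f => (matching_number (conj_column g) J
        [seq (h.1, plain_column g h) | h <- s] (B :\ f)).+1) Q0.
    by exists f.
  by move=> h; move: wn; rewrite /w big_pred0.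
case=> [->|[f /andP[fB /and3P[/= ef /eqP Jf /eqP cf]] ->]].
  have [M [h1 h2 h3 h4]] := IH B us; exists M; split => // x xM.
  by have [] := h2 x xM; rewrite !inE => ->; rewrite orbT.
have [M [h1 h2 h3 h4]] := IH (B :\ f) us.
have eM x : x \in M -> x.1 <> e.
  by move=> /h2[]; rewrite inE => xs _ xe; rewrite -xe xs in es.
have fM x : x \in M -> x.2 <> f.
  by move=> /h2[_]; rewrite !inE => /andP[/eqP].
exists ((e, f) |: M); split.
- exact: matching_add.
- move=> x; rewrite inE => /setU1P[->|xM] /=; first by rewrite !inE eqxx.
  by have [] := h2 x xM; rewrite !inE => -> /andP[_ ->]; rewrite orbT.
- by move=> x /setU1P[-> //|]; exact: h3.
- by rewrite cardsU1 h4 (_ : _ \notin _) //; apply/negP => /eM.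
Qed.

End CrossingMatchings.

(** * From matchings to circuit coverings *)

Section Coverings.
Context (d p : nat) (g : 'I_p -> gidx d).
Local Notation label := ('I_p * bool)%type.
Local Open Scope set_scope.
Local Open Scope nat_scope.
Implicit Types (M N : {set label * label}) (S : {set 'I_p})
  (C D : {set {set edge p}}) (J : {ffun 'I_p -> 'I_d}).
Local Notation pcol := (plain_column g).
Local Notation ccol := (conj_column g).
Local Notation matching := (matching pcol ccol).

Definition plain_edge (h : label) : edge p := (h.1, (false, h.2)).
Definition conj_edge (h : label) : edge p := (h.1, (true, h.2)).
Definition block (x : label * label) : {set edge p} :=
  [set plain_edge x.1; conj_edge x.2].

Lemma plain_inj : injective plain_edge.
Proof. by move=> [i s] [j t] [-> ->]. Qed.

Lemma conj_inj : injective conj_edge.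
Proof. by move=> [i s] [j t] [-> ->]. Qed.

Lemma plain_block h x : (plain_edge h \in block x) = (h == x.1).
Proof.
rewrite !inE (inj_eq plain_inj); case: (h == x.1) => //=.
by apply/negP => /eqP[].
Qed.

Lemma conj_block h x : (conj_edge h \in block x) = (h == x.2).
Proof.
rewrite !inE (inj_eq conj_inj) orbC; case: (h == x.2) => //=.
by apply/negP => /eqP[].
Qed.

Lemma block_inj : injective block.
Proof.
move=> [a b] [a' b'] e; have := plain_block a (a, b); rewrite e plain_block eqxx.
have := conj_block b (a, b); rewrite e conj_block eqxx /=.
by move=> /eqP -> /eqP ->.
Qed.

Lemma edgeP (e : edge p) : (exists h, e = plain_edge h) \/ (exists h, e = conj_edge h).
Proof. by case: e => i [[|] s]; [right | left]; exists (i, s). Qed.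

Lemma two_circuit_block J B : two_circuit g J B ->
  exists x, [/\ B = block x, pcol x.1 = ccol x.2 & J x.1.1 = J x.2.1].
Proof.
move=> /existsP[e /existsP[f /and5P[ne cf /eqP Jef /eqP col /eqP ->]]].
have [[h eh]|[h eh]] := edgeP e; last by rewrite eh in ne.
have [[k fk]|[k fk]] := edgeP f; first by rewrite fk in cf.
by exists (h, k); rewrite /block /= -eh -fk; split => //; move: Jef col; rewrite eh fk.
Qed.

Lemma block_two_circuit J x : pcol x.1 = ccol x.2 -> J x.1.1 = J x.2.1 ->
  two_circuit g J (block x).
Proof.
move=> col Jx; apply/existsP; exists (plain_edge x.1); apply/existsP.
by exists (conj_edge x.2); rewrite /gterm /= Jx eqxx -[column g _]/(pcol _) col !eqxx.
Qed.

Definition pairs_of D : {set label * label} := [set x | block x \in D].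

Lemma pairs_of_matching J C D : circuit_covering g J C -> D \subset C ->
  (forall B, B \in D -> two_circuit g J B) ->
  matching (pairs_of D) /\ #|pairs_of D| = #|D|.
Proof.
move=> /andP[/and3P[_ /finset.trivIsetP tC _] _] /fintype.subsetP DC D2.
have eqb x y (e : edge p) : x \in pairs_of D -> y \in pairs_of D ->
    e \in block x -> e \in block y -> x = y.
  move=> xD yD ex ey; rewrite !inE in xD yD; apply: block_inj; apply/eqP.
  apply: contraTT ex => xy.
  have /pred0P/(_ e) /= := tC _ _ (DC _ xD) (DC _ yD) xy.
  by rewrite ey andbT => ->.
split; last first.
  rewrite -(card_imset _ block_inj); apply: eq_card => B; apply/imsetP/idP.
    by move=> [x]; rewrite inE => xD ->.
  move=> BD; have [x [Bx _ _]] := two_circuit_block (D2 _ BD).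
  by exists x => //; rewrite inE -Bx.
split.
- move=> x y xD yD xy; apply: (eqb x y (plain_edge x.1)); rewrite ?plain_block ?xy //.
- move=> x y xD yD xy; apply: (eqb x y (conj_edge x.2)); rewrite ?conj_block ?xy //.
- move=> x; rewrite inE => /D2/two_circuit_block[y [/block_inj <- //]].
Qed.

Definition labels S : {set label} := [set h | h.1 \in S].

Lemma card_labels S : #|labels S| = 2 * #|S|.
Proof.
rewrite (_ : labels S = finset.setX S [set: bool]); last first.
  by apply/setP => h; rewrite !inE andbT.
by rewrite cardsX cardsT card_bool mulnC.
Qed.

(** Smartness freed from [J] and the covering. Pairs between different terms are never disregarded,
    so such a matching always makes S smart for a constant index. *)
Definition locally_perfect S : Prop :=
  exists N, [/\ matching N, between (labels S) (labels S) N,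
    forall x, x \in N -> x.1.1 != x.2.1 & #|N| = 2 * #|S|].

Lemma perfect_fst S N : matching N -> between (labels S) (labels S) N ->
  #|N| = 2 * #|S| -> fst @: N = labels S.
Proof.
move=> [h1 _ _] b NS; apply/eqP; rewrite eqEcard card_in_imset // NS card_labels.
rewrite leqnn andbT; apply/fintype.subsetP => _ /imsetP[x xN ->].
by have [] := b x xN.
Qed.

Lemma perfect_snd S N : matching N -> between (labels S) (labels S) N ->
  #|N| = 2 * #|S| -> snd @: N = labels S.
Proof.
move=> [_ h2 _] b NS; apply/eqP; rewrite eqEcard card_in_imset // NS card_labels.
rewrite leqnn andbT; apply/fintype.subsetP => _ /imsetP[x xN ->].
by have [] := b x xN.
Qed.

Section ConstantIndex.
Variable j0 : 'I_d.
Let J0 : {ffun 'I_p -> 'I_d} := [ffun => j0].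

(** With a single black vertex, equal columns suffice for a plain and a conjugated edge to form a
    circuit. *)
Lemma matching_covering M : matching M -> #|M| = #|{: label}| ->
  circuit_covering g J0 [set block x | x in M].
Proof.
move=> [h1 h2 h3] Mfull.
have f1 : fst @: M = [set: label].
  by apply/eqP; rewrite eqEcard card_in_imset // Mfull cardsT leqnn finset.subsetT.
have f2 : snd @: M = [set: label].
  by apply/eqP; rewrite eqEcard card_in_imset // Mfull cardsT leqnn finset.subsetT.
apply/andP; split; last first.
  apply/forall_inP => _ /imsetP[x xM ->]; apply/hasP.
  exists [:: plain_edge x.1; conj_edge x.2].
    rewrite mem_permutations; apply: uniq_perm; rewrite ?enum_uniq //.
      by rewrite /= inE andbT; apply/negP => /eqP[].
    by move=> e; rewrite mem_enum !inE.
  rewrite /= /target /source /= -[column g _]/(pcol _) h3 // eqxx.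
  by rewrite /J0 !ffunE eqxx.
apply/and3P; split.
- rewrite finset.eqEsubset finset.subsetT; apply/fintype.subsetP => e _; apply/finset.bigcupP.
  have [[h ->]|[h ->]] := edgeP e.
    have : h \in fst @: M by rewrite f1 inE.
    by case/imsetP=> x xM ->; exists (block x); rewrite ?imset_f ?plain_block.
  have : h \in snd @: M by rewrite f2 inE.
  by case/imsetP=> x xM ->; exists (block x); rewrite ?imset_f ?conj_block.
- apply/finset.trivIsetP => _ _ /imsetP[x xM ->] /imsetP[y yM ->] xy.
  apply/pred0P => e /=; apply/negP => /andP[ex ey]; case/negP: xy; apply/eqP.
  congr block; move: ex ey; have [[h ->]|[h ->]] := edgeP e.
    by rewrite !plain_block => /eqP -> /eqP; exact: h1.
  by rewrite !conj_block => /eqP -> /eqP; exact: h2.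
- apply/imsetP => -[x _ /setP/(_ (plain_edge x.1))].
  by rewrite plain_block inE eqxx.
Qed.

Lemma matching_smart M S : matching M -> #|M| = #|{: label}| ->
  (forall x, x \in M -> x.1.1 \in S -> x.2.1 \in S /\ x.1.1 != x.2.1) ->
  smart g J0 [set block x | x in M] #|S| S.
Proof.
move=> [h1 h2 h3] Mfull MS; rewrite /smart eqxx /=; apply/andP; split.
  by apply/forall_inP => i _; apply/forall_inP => i' _; rewrite !ffunE.
have -> : counted_two_circuits g J0 [set block x | x in M] S =
    block @: [set x in M | x.1.1 \in S].
  apply/setP => B; rewrite inE; apply/andP/imsetP.
    move=> [+ _]; rewrite inE => /andP[/imsetP[x xM ->] /andP[_ /forall_inP xS]].
    exists x => //; rewrite inE xM /=.
    by apply: (xS (plain_edge x.1)); rewrite plain_block.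
  move=> [x]; rewrite inE => /andP[xM xS] ->.
  have [x2S xne] := MS x xM xS; split.
    rewrite inE imset_f //= block_two_circuit ?h3 ?ffunE //=.
    apply/forall_inP => e; have [[h ->]|[h ->]] := edgeP e.
      by rewrite plain_block => /eqP ->.
    by rewrite conj_block => /eqP ->.
  (* A block joining two terms is internal to neither, so it is not disregarded. *)
  apply/forallP => i; rewrite inE negb_and; apply/orP; left.
  rewrite inE negb_and; apply/orP; right; apply/negP.
  move=> /andP[_ /forall_inP xi]; case/negP: xne.
  have := xi (plain_edge x.1); have := xi (conj_edge x.2).
  rewrite plain_block conj_block !eqxx !inE => /(_ isT) /eqP <- /(_ isT) /eqP.
  by rewrite /gterm /= => ->.
rewrite card_imset; last exact: block_inj.
have -> : #|[set x in M | x.1.1 \in S]| = #|labels S|; last first.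
  by rewrite card_labels.
rewrite -(card_in_imset (f := fst) (D := [set x in M | x.1.1 \in S])); last first.
  by move=> x y; rewrite !inE => /andP[xM _] /andP[yM _]; exact: h1.
apply: eq_card => h; rewrite inE; apply/imsetP/idP.
  by move=> [x]; rewrite inE => /andP[_ xS] ->.
have : h \in fst @: M.
  rewrite (_ : fst @: M = [set: label]) ?inE //.
  by apply/eqP; rewrite eqEcard card_in_imset // Mfull cardsT leqnn finset.subsetT.
by case/imsetP=> x xM -> xS; exists x => //; rewrite inE xM.
Qed.

(** The local matchings live on disjoint sets of factors, so their union is a matching; balance
    completes it to a full one, which is a covering. *)
Lemma smart_family (F : {set {set 'I_p}}) :
  (forall c, #|[set h in [set: label] | pcol h == c]| =
             #|[set h in [set: label] | ccol h == c]|) ->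
  finset.trivIset F -> (forall S, S \in F -> locally_perfect S) ->
  exists2 C, circuit_covering g J0 C &
    forall S, S \in F -> smart g J0 C #|S| S.
Proof.
move=> bal /finset.trivIsetP tF lp.
have eqS S S' i : S \in F -> S' \in F -> i \in S -> i \in S' -> S = S'.
  move=> SF S'F iS iS'; apply/eqP; apply: contraTT iS => SS'.
  by have /pred0P/(_ i) /= := tF _ _ SF S'F SS'; rewrite iS' andbT => ->.
pose good S N := S \in F -> [/\ matching N, between (labels S) (labels S) N,
  forall x, x \in N -> x.1.1 != x.2.1 & #|N| = 2 * #|S|].
have [S|N hN] := @boolp.choice _ _ good.
  case: (boolP (S \in F)) => [/lp[N hN]|SF]; first by exists N.
  by exists finset.set0 => SF'; rewrite SF' in SF.
pose M0 := finset.cover (N @: F).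
have M0P x : x \in M0 -> exists2 S, S \in F & x \in N S.
  by move=> /finset.bigcupP[_ /imsetP[S SF ->] xS]; exists S.
have mM0 : matching M0.
  split=> [x y|x y|x].
  - move=> /M0P[S SF xS] /M0P[S' S'F yS'] xy.
    have [[k1 _ _] b _ _] := hN S SF; have [_ b' _ _] := hN S' S'F.
    have e : S = S'.
      apply: (eqS _ _ x.1.1) => //; first by have [] := b x xS; rewrite !inE.
      by rewrite xy; have [] := b' y yS'; rewrite !inE.
    by subst S'; apply: k1.
  - move=> /M0P[S SF xS] /M0P[S' S'F yS'] xy.
    have [[_ k1 _] b _ _] := hN S SF; have [_ b' _ _] := hN S' S'F.
    have e : S = S'.
      apply: (eqS _ _ x.2.1) => //; first by have [] := b x xS; rewrite !inE.
      by rewrite xy; have [] := b' y yS'; rewrite !inE.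
    by subst S'; apply: k1.
  - by move=> /M0P[S SF xS]; have [[_ _ k] _ _ _] := hN S SF; exact: k.
have bM0 : between [set: label] [set: label] M0 by move=> x _; rewrite !inE.
(* The completion cannot alter the pairs inside a set of F, whose factors are already all
   matched. *)
have [M [mM M0M _ Mfull]] := matching_extend bal mM0 bM0.
rewrite cardsT in Mfull.
exists [set block x | x in M]; first exact: matching_covering.
move=> S SF; apply: matching_smart => // x xM xS.
have [mN bN eN cN] := hN S SF.
have : x.1 \in fst @: N S by rewrite (perfect_fst mN bN cN) inE.
case/imsetP=> y yN xy.
have yM : y \in M.
  by apply: (fintype.subsetP M0M); apply/finset.bigcupP; exists (N S); rewrite ?imset_f.
have [h1 _ _] := mM; have <- := h1 _ _ yM xM (esym xy).
by split; [have [] := bN y yN; rewrite !inE | exact: eN].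
Qed.

End ConstantIndex.
End Coverings.

(** * Conjugate terms and smart pairs *)

Section Twins.
Context (d p : nat) (g : 'I_p -> gidx d).
Local Notation label := ('I_p * bool)%type.
Local Open Scope set_scope.
Local Open Scope nat_scope.
Implicit Types (M N : {set label * label}) (S : {set 'I_p})
  (C D : {set {set edge p}}) (J : {ffun 'I_p -> 'I_d}) (i : 'I_p).
Local Notation pcol := (plain_column g).
Local Notation ccol := (conj_column g).
Local Notation matching := (matching pcol ccol).
Local Notation locally_perfect := (locally_perfect g).

Definition pcount i c : nat := #|[set h in labels [set i] | pcol h == c]|.
Definition ccount i c : nat := #|[set h in labels [set i] | ccol h == c]|.

(* [twin i i'] : the [i']-th term is the complex conjugate of the [i]-th one, up
   to the symmetries of gamma. *)
Definition twin i i' : bool :=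
  [forall c, (pcount i c == ccount i' c) && (pcount i' c == ccount i c)].

Lemma twinP i i' : reflect
  (forall c, pcount i c = ccount i' c /\ pcount i' c = ccount i c) (twin i i').
Proof.
apply: (iffP forallP) => h c; first by have /andP[/eqP -> /eqP ->] := h c.
by have [-> ->] := h c; rewrite !eqxx.
Qed.

Lemma twin_sym i i' : twin i i' -> twin i' i.
Proof. by move=> /twinP h; apply/twinP => c; have [-> ->] := h c. Qed.

(** Conjugation exchanges plain and conjugated columns, so chains of odd length compose to a twin
    relation while even ones give equal types. *)
Lemma twin_trans3 w x y z : twin w x -> twin x y -> twin y z -> twin w z.
Proof.
move=> /twinP h1 /twinP h2 /twinP h3; apply/twinP => c.
have [a1 a2] := h1 c; have [b1 b2] := h2 c; have [c1 c2] := h3 c.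
by rewrite a1 -b2 c1 c2 -b1 a2.
Qed.

(** The plain factors of each term are matched with the conjugated factors of the other, by
    extending two empty matchings. *)
Lemma twin_locally_perfect i i' : i != i' -> twin i i' ->
  locally_perfect [set i; i'].
Proof.
move=> ii' /twinP tw.
have m0 : matching finset.set0.
  by split => [x y|x y|x]; rewrite finset.in_set0.
have b0 X Y : between X Y (finset.set0 : {set label * label}).
  by move=> x; rewrite finset.in_set0.
have [N1 [[f1 s1 c1] _ b1 k1]] := matching_extend (fun c => (tw c).1) m0 (b0 _ _).
have [N2 [[f2 s2 c2] _ b2 k2]] := matching_extend (fun c => (tw c).2) m0 (b0 _ _).
have p1 x : x \in N1 -> x.1.1 = i /\ x.2.1 = i'.
  by move=> /b1[]; rewrite !inE => /eqP -> /eqP ->.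
have p2 x : x \in N2 -> x.1.1 = i' /\ x.2.1 = i.
  by move=> /b2[]; rewrite !inE => /eqP -> /eqP ->.
exists (N1 :|: N2); split.
- split=> [x y|x y|x].
  + move=> /setUP[] xN /setUP[] yN xy; try by [apply: f1 | apply: f2].
      by case/eqP: ii'; rewrite -(p1 x xN).1 -(p2 y yN).1 xy.
    by case/eqP: ii'; rewrite -(p1 y yN).1 -(p2 x xN).1 xy.
  + move=> /setUP[] xN /setUP[] yN xy; try by [apply: s1 | apply: s2].
      by case/eqP: ii'; rewrite -(p1 x xN).2 -(p2 y yN).2 xy.
    by case/eqP: ii'; rewrite -(p1 y yN).2 -(p2 x xN).2 xy.
  + by case/setUP; [exact: c1 | exact: c2].
- move=> x /setUP[/p1|/p2] [e1 e2]; rewrite !inE e1 e2 !eqxx ?orbT //.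
- by move=> x /setUP[/p1|/p2] [-> ->] //; rewrite eq_sym.
- rewrite cardsU k1 k2 !card_labels !cards1 cards2 ii' (_ : N1 :&: N2 = finset.set0).
    by rewrite cards0.
  apply/setP => x; rewrite !inE; apply/negP => /andP[/p1[e _] /p2[e' _]].
  by case/eqP: ii'; rewrite -e -e'.
Qed.

Section PerfectCount.
Context (N : {set label * label}) (S : {set 'I_p}) (mN : matching N)
  (bN : between (labels S) (labels S) N) (cN : #|N| = 2 * #|S|).

Lemma card_fst (Q : pred label) :
  #|[set x in N | Q x.1]| = #|[set h in labels S | Q h]|.
Proof.
have [f1 _ _] := mN.
rewrite -(card_in_imset (f := fst)); last first.
  by move=> x y; rewrite !inE => /andP[xN _] /andP[yN _]; exact: f1.
apply: eq_card => h; rewrite -(perfect_fst mN bN cN) inE.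
apply/imsetP/andP => [[x]|[/imsetP[x xN ->] Q1]].
  by rewrite inE => /andP[xN Qx] ->; rewrite imset_f.
by exists x; rewrite // inE xN.
Qed.

Lemma card_snd (Q : pred label) :
  #|[set x in N | Q x.2]| = #|[set h in labels S | Q h]|.
Proof.
have [_ f2 _] := mN.
rewrite -(card_in_imset (f := snd)); last first.
  by move=> x y; rewrite !inE => /andP[xN _] /andP[yN _]; exact: f2.
apply: eq_card => h; rewrite -(perfect_snd mN bN cN) inE.
apply/imsetP/andP => [[x]|[/imsetP[x xN ->] Q1]].
  by rewrite inE => /andP[xN Qx] ->; rewrite imset_f.
by exists x; rewrite // inE xN.
Qed.

End PerfectCount.

(** With only two terms, each crossing pair leads from one to the other, so the matching is a pair
    of column-preserving bijections. *)
Lemma locally_perfect_twin i i' : i != i' -> locally_perfect [set i; i'] ->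
  twin i i'.
Proof.
move=> ii' [N [mN bN eN cN]].
have [_ _ h3] := mN.
have half a b c : a != b -> [set a; b] = [set i; i'] -> pcount a c = ccount b c.
  move=> ab abE; rewrite -abE in bN cN.
  have -> : pcount a c = #|[set x in N | (x.1.1 == a) && (pcol x.1 == c)]|.
    rewrite (card_fst mN bN cN (fun h => (h.1 == a) && (pcol h == c))).
    apply: eq_card => h; rewrite !inE; case: (h.1 == a) => //=.
    by rewrite andbF.
  have -> : ccount b c = #|[set x in N | (x.2.1 == b) && (ccol x.2 == c)]|.
    rewrite (card_snd mN bN cN (fun h => (h.1 == b) && (ccol h == c))).
    apply: eq_card => h; rewrite !inE; case: (h.1 == b) => //=.
      by rewrite orbT.
    by rewrite andbF.
  apply: eq_card => x; rewrite !inE; case xN : (x \in N) => //=.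
  rewrite h3 //; congr (_ && _).
  have := eN x xN; have [] := bN x xN; rewrite !inE.
  move=> /orP[] /eqP -> /orP[] /eqP ->; rewrite ?eqxx // ?(eq_sym b a) (negPf ab) //.
apply/twinP => c; split; first exact: half.
by apply: half; rewrite 1?eq_sym // finset.setUC.
Qed.

(** An internal 2-circuit equates a plain and a conjugated column, so its term has type kkmn, kkmm
    or kkkk. The convention leaves only kkkk, with a single internal circuit. *)
Lemma internal_counted J C S x : block x \in counted_two_circuits g J C S ->
  pcol x.1 = ccol x.2 -> x.1.1 = x.2.1 ->
  (exists c, forall s, pcol (x.1.1, s) = c /\ ccol (x.1.1, s) = c) /\
  #|two_circuits_in g J C [set x.1.1]| != 2.
Proof.
case: x => -[i s] [i' s'] /= + + ii'; rewrite -{}ii'.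
rewrite inE => /andP[xD /forallP/(_ i)]; rewrite inE negb_and.
have -> : block ((i, s), (i, s')) \in two_circuits_in g J C [set i].
  move: xD; rewrite !inE => /andP[-> /andP[-> _]] /=; apply/forall_inP => e.
  have [[h ->]|[h ->]] := edgeP e.
    by rewrite plain_block inE => /eqP ->.
  by rewrite conj_block inE => /eqP ->.
rewrite /= !negb_or negb_and => /and3P[n1 n2 n3] cc.
suff k4 : type_kkkk (g i).
  rewrite k4 /= in n3; split => //.
  move: k4; rewrite /plain_column /conj_column /column /gterm /=.
  case: (g i) => [[[k l] m] n] /= /and3P[/eqP <- /eqP <- /eqP <-].
  by exists k => -[].
move: cc n1 n2; rewrite /plain_column /conj_column /column /gterm /type_kkmn /type_kkmm /=.
case: (g i) => [[[k l] m] n] /=.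
case: s {xD} => /=; case: s' => /= ->; rewrite ?eqxx /= ?andbT ?orbF.
all: by repeat (case: eqVneq => [?|?] //=; subst).
Qed.

(** The four circuits match all factors of the two terms. Counted by the terms they join, they form
    a 2 x 2 matrix with row and column sums 2, so both terms have equally many internal circuits:
    none, or exactly one each. *)
Lemma smart_pair_twin J C S : circuit_covering g J C -> smart_pair g J C S ->
  exists i i', [/\ i != i', twin i i' & S = [set i; i']].
Proof.
move=> cov /and3P[/cards2P[i [i' [ii' SE]]] _ /eqP card4].
exists i, i'; split => //.
pose D := counted_two_circuits g J C S.
have subC A : two_circuits_in g J C A \subset C.
  by apply/fintype.subsetP => B; rewrite inE => /andP[].
have twoC A B : B \in two_circuits_in g J C A -> two_circuit g J B.
  by rewrite inE => /and3P[].
have Dsub : D \subset two_circuits_in g J C S.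
  by apply/fintype.subsetP => B; rewrite inE => /andP[].
have betw A x : block x \in two_circuits_in g J C A -> x.1.1 \in A /\ x.2.1 \in A.
  rewrite inE => /andP[_ /andP[_ /forall_inP xA]].
  split; [apply: (xA (plain_edge x.1)) | apply: (xA (conj_edge x.2))].
    by rewrite plain_block.
  by rewrite conj_block.
have [N [mN bN NS NP]] : exists N, [/\ matching N, between (labels S) (labels S) N,
    #|N| = 2 * #|S| & forall x, x \in N -> block x \in D].
  have [mN cN] := pairs_of_matching cov (fintype.subset_trans Dsub (subC S))
    (fun B BD => twoC S B (fintype.subsetP Dsub B BD)).
  exists (pairs_of D); split => //.
  - move=> x; rewrite inE => /(fintype.subsetP Dsub) /betw[h1 h2].
    by rewrite !inE.
  - by rewrite cN card4 SE cards2 ii'.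
  - by move=> x; rewrite inE.
have [h1 h2 h3] := mN.
pose n a b := #|[set x in N | (x.1.1 == a) && (x.2.1 == b)]|.
have row a : a \in S -> n a i + n a i' = 2.
  move=> aS; have := card_fst mN bN NS (fun h => h.1 == a).
  rewrite [RHS](_ : _ = #|labels [set a]|); last first.
    by apply: eq_card => h; rewrite !inE; case: eqP => [->|]; rewrite ?aS ?andbF.
  rewrite card_labels cards1 muln1 => <-.
  rewrite -(cardsID [set x | x.2.1 == i]); congr (_ + _); apply: eq_card => x.
    by rewrite !inE andbA.
  rewrite !inE; case xN : (x \in N); rewrite ?andbF //=.
  rewrite [RHS]andbC; congr (_ && _).
  have [_] := bN x xN; rewrite SE !inE => /orP[] /eqP ->; rewrite eqxx ?(negPf ii') //.
  by rewrite eq_sym ii'.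
have colm a : a \in S -> n i a + n i' a = 2.
  move=> aS; have := card_snd mN bN NS (fun h => h.1 == a).
  rewrite [RHS](_ : _ = #|labels [set a]|); last first.
    by apply: eq_card => h; rewrite !inE; case: eqP => [->|]; rewrite ?aS ?andbF.
  rewrite card_labels cards1 muln1 => <-.
  rewrite -(cardsID [set x | x.1.1 == i]); congr (_ + _); apply: eq_card => x.
    by rewrite !inE -andbA [(x.1.1 == _) && _]andbC.
  rewrite !inE; case xN : (x \in N); rewrite ?andbF //=.
  congr (_ && _).
  have [+ _] := bN x xN; rewrite SE !inE => /orP[] /eqP ->; rewrite eqxx ?(negPf ii') //.
  by rewrite eq_sym ii'.
have iS : i \in S by rewrite SE !inE eqxx.
have i'S : i' \in S by rewrite SE !inE eqxx orbT.
have witness a b : 0 < n a b -> exists2 x, x \in N & x.1.1 = a /\ x.2.1 = b.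
  move=> /card_gt0P[x]; rewrite inE => /andP[xN /andP[/eqP <- /eqP <-]].
  by exists x.
have internal a : a \in S -> 0 < n a a -> n a a != 2 /\
    exists c, forall s, pcol (a, s) = c /\ ccol (a, s) = c.
  move=> aS /witness[x xN [x1 x2]]; have xD := NP x xN.
  have [cst card2] := internal_counted xD (h3 x xN) (etrans x1 (esym x2)).
  rewrite x1 in cst card2; split => //; apply: contra card2 => /eqP n2.
  have [mT cT] := pairs_of_matching cov (subC [set a]) (twoC [set a]).
  rewrite eqn_leq -{1}cT; apply/andP; split.
    have bT : between (labels [set a]) (labels [set a])
        (pairs_of (two_circuits_in g J C [set a])).
      by move=> y; rewrite inE => /betw[]; rewrite !inE.
    by have := card_matching_le mT bT; rewrite card_labels cards1.
  rewrite -cT -n2; apply: subset_leq_card; apply/fintype.subsetP => y.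
  rewrite !inE => /andP[/NP yD /andP[y1 y2]].
  have := fintype.subsetP Dsub _ yD; rewrite inE => /andP[yC /andP[yt _]].
  rewrite yC yt /=; apply/forall_inP => e; have [[h ->]|[h ->]] := edgeP e.
    by rewrite plain_block inE => /eqP ->.
  by rewrite conj_block inE => /eqP ->.
have r1 := row i iS; have r2 := row i' i'S; have k1 := colm i iS.
(* Without internal circuits the matching is crossing. Otherwise both terms have type kkkk. *)
case: (posnP (n i i)) => [nii|nii].
  apply: locally_perfect_twin => //; rewrite -SE; exists N; split => // x xN.
  have nii' : n i' i' = 0 by lia.
  apply/negP => /eqP xx; have [+ _] := bN x xN; rewrite inE SE !inE.
  have no a : n a a = 0 -> x.1.1 <> a.
    move=> /eqP; rewrite cards_eq0 => /eqP /setP /(_ x); rewrite !inE xN -xx.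
    by case: eqP.
  by case/orP => /eqP; exact: no.
have [nii2 [c hc]] := internal i iS nii.
have [_ [c' hc']] : n i' i' != 2 /\
    exists c, forall s, pcol (i', s) = c /\ ccol (i', s) = c.
  by apply: internal => //; lia.
(* One internal circuit leaves one crossing circuit in this row, which forces the constant columns
   of the two terms to agree. *)
have [|[[a s] [b t]] xN /= [xa xb]] := witness i i'; first by lia.
have cc' : c = c'.
  by rewrite -(hc s).1 -(hc' t).2 -xa -xb; exact: h3 _ xN.
subst c' a b.
apply/twinP => e; rewrite /pcount /ccount.
have eqc a (f : label -> 'I_d) : (forall s, f (a, s) = c) ->
    #|[set h in labels [set a] | f h == e]| = if c == e then 2 else 0.
  move=> fc; case: ifP => ce.
    rewrite -[RHS](_ : #|labels [set a]| = 2); last by rewrite card_labels cards1.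
    by apply: eq_card => -[b s']; rewrite !inE /=; case: eqP => [->|]; rewrite ?fc ?ce.
  apply/eqP; rewrite cards_eq0; apply/eqP/setP => -[b s']; rewrite !inE /=.
  by case: eqP => [->|] //=; rewrite fc ce.
by split; rewrite (eqc _ pcol) ?(eqc _ ccol) // => s';
  [case: (hc' s') | case: (hc s') | case: (hc s') | case: (hc' s')].
Qed.

(** For balanced columns these are precisely the families of disjoint smart pairs, described without
    [J] and the covering. *)
Definition pairing (Q : {set {set 'I_p}}) : bool :=
  finset.trivIset Q && [forall S in Q, [exists i, exists i',
    [&& i != i', twin i i' & S == [set i; i']]]].

Lemma pairingP (Q : {set {set 'I_p}}) : reflect
  (finset.trivIset Q /\ forall S, S \in Q ->
     exists i i', [/\ i != i', twin i i' & S = [set i; i']]) (pairing Q).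
Proof.
apply: (iffP andP) => -[tQ hQ]; split => //.
  move=> S /(forall_inP hQ) /existsP[i /existsP[i' /and3P[h1 h2 /eqP h3]]].
  by exists i, i'.
apply/forall_inP => S /hQ[i [i' [h1 h2 ->]]]; apply/existsP; exists i.
by apply/existsP; exists i'; rewrite h1 h2 eqxx.
Qed.

Lemma trivIset_eq (T : finType) (Q : {set {set T}}) (S S' : {set T}) x :
  finset.trivIset Q -> S \in Q -> S' \in Q -> x \in S -> x \in S' -> S = S'.
Proof.
move=> /finset.trivIsetP tQ SQ S'Q xS xS'; apply/eqP; apply: contraTT xS => SS'.
by have /pred0P/(_ x) /= := tQ _ _ SQ S'Q SS'; rewrite xS' andbT => ->.
Qed.

Lemma trivIset_add (T : finType) (Q : {set {set T}}) (S : {set T}) :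
  finset.trivIset Q -> (forall (S' : {set T}) x, S' \in Q -> x \in S -> x \notin S') ->
  finset.trivIset (S |: Q).
Proof.
move=> /finset.trivIsetP tQ SQ; apply/finset.trivIsetP => A B.
have dis A' : A' \in Q -> [disjoint S & A']%B.
  move=> AQ; apply/pred0P => x /=; apply/negP => /andP[xS xA].
  by case/negP: (SQ A' x AQ xS).
move=> /setU1P[->|AQ] /setU1P[->|BQ]; rewrite ?eqxx //.
- by move=> _; exact: dis.
- by move=> _; rewrite disjoint_sym; exact: dis.
- exact: tQ.
Qed.

Lemma pairing_add (Q : {set {set 'I_p}}) i i' : pairing Q -> i != i' -> twin i i' ->
  (forall S, S \in Q -> i \notin S /\ i' \notin S) ->
  pairing ([set i; i'] |: Q) /\ #|[set i; i'] |: Q| = #|Q|.+1.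
Proof.
move=> /pairingP[tQ hQ] ii' tw out; split.
  apply/pairingP; split.
    apply: trivIset_add => // S' x /out[n1 n2].
    by rewrite !inE => /orP[] /eqP ->.
  by move=> S /setU1P[->|/hQ //]; exists i, i'.
rewrite cardsU1 (_ : _ \notin _) //; apply/negP => /out[].
by rewrite !inE eqxx.
Qed.

Lemma pairing_sub (Q Q' : {set {set 'I_p}}) : Q' \subset Q -> pairing Q -> pairing Q'.
Proof.
move=> s /pairingP[tQ hQ]; apply/pairingP; split.
  exact: finset.trivIsetS tQ.
by move=> S /(fintype.subsetP s) /hQ.
Qed.

(* If [{x, y}] meets [{x, z}] and [{y, w}] in [Q], then [z] and [w] are twins as
   well, and the two pairs can be replaced by [{x, y}] and [{z, w}]. *)
Lemma pairing_exchange (Q : {set {set 'I_p}}) x y : pairing Q -> x != y -> twin x y ->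
  [set x; y] \notin Q ->
  exists Q', [/\ pairing Q', #|Q| <= #|Q'|, [set x; y] \in Q' &
    forall S, S \in Q -> x \notin S -> y \notin S -> S \in Q'].
Proof.
move=> pQ xy tw nQ; have /pairingP[tQ hQ] := pQ.
pose Qo := [set S in Q | (x \notin S) && (y \notin S)].
have QoQ : Qo \subset Q by apply/fintype.subsetP => S; rewrite inE => /andP[].
have pQo := pairing_sub QoQ pQ.
have out S : S \in Qo -> x \notin S /\ y \notin S.
  by rewrite inE => /and3P[].
have [pQ1 cQ1] := pairing_add pQo xy tw out.
have keep (Q' : {set {set 'I_p}}) : [set x; y] |: Qo \subset Q' ->
    [set x; y] \in Q' /\ forall S, S \in Q -> x \notin S -> y \notin S -> S \in Q'.
  move=> /fintype.subsetP s; split; first by apply: s; rewrite setU11.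
  by move=> S SQ xS yS; apply: s; rewrite !inE SQ xS yS orbT.
(* The member of Q containing [a], with the empty set, which is not in Q, as default. *)
have meet a : exists S, (forall T, T \in Q -> a \in T -> T = S) /\
    (S \in Q -> exists2 b, a != b & S = [set a; b] /\ twin a b).
  case: (pickP (fun S => (S \in Q) && (a \in S))) => [S /andP[SQ aS]|no].
    exists S; split=> [T TQ aT|_]; first exact: (trivIset_eq tQ TQ SQ aT aS).
    have [i [i' [ii' tii' SE]]] := hQ S SQ.
    move: aS; rewrite SE !inE => /orP[] /eqP ->; first by exists i'.
    by exists i; rewrite 1?eq_sym // finset.setUC; split => //; exact: twin_sym.
  exists finset.set0; split=> [T TQ aT|/hQ[i [i' [_ _ /setP/(_ i)]]]].
    by have := no T; rewrite TQ aT.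
  by rewrite !inE eqxx.
have [Sx [Sx1 Sx2]] := meet x; have [Sy [Sy1 Sy2]] := meet y.
have Qsub : Q \subset Qo :|: [set S in Q | (S == Sx) || (S == Sy)].
  apply/fintype.subsetP => S SQ; rewrite !inE SQ /=.
  case: (boolP (x \in S)) => [/(Sx1 _ SQ) ->|_]; first by rewrite eqxx.
  case: (boolP (y \in S)) => [/(Sy1 _ SQ) ->|_] //=; by rewrite eqxx orbT.
have cQ := leq_trans (subset_leq_card Qsub) (leq_card_setU _ _).
case: (boolP [&& Sx \in Q, Sy \in Q & Sx != Sy]) => [/and3P[SxQ SyQ SS]|SS].
  have [z xz [SxE txz]] := Sx2 SxQ; have [w yw [SyE tyw]] := Sy2 SyQ.
  have dis a : a \in Sx -> a \in Sy -> False.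
    move=> ax ay; case/eqP: SS; exact: (trivIset_eq tQ SxQ SyQ ax ay).
  have zw : z != w.
    apply/eqP => zw; apply: (dis z); first by rewrite SxE !inE eqxx orbT.
    by rewrite SyE zw !inE eqxx orbT.
  have tzw : twin z w := twin_trans3 (twin_sym txz) tw tyw.
  have zy : z != y.
    apply/eqP => zy; apply: (dis z); first by rewrite SxE !inE eqxx orbT.
    by rewrite SyE zy !inE eqxx.
  have wx : w != x.
    apply/eqP => wx; apply: (dis w); last by rewrite SyE !inE eqxx orbT.
    by rewrite SxE wx !inE eqxx.
  have out2 S : S \in [set x; y] |: Qo -> z \notin S /\ w \notin S.
    move=> /setU1P[->|SQo].
      by rewrite !inE !negb_or (eq_sym z x) xz zy wx (eq_sym w y) yw.
    have [xS yS] := out S SQo; have SQ := fintype.subsetP QoQ S SQo.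
    split; apply/negP => inS.
      have SSx : S = Sx.
        by apply: (trivIset_eq tQ SQ SxQ inS); rewrite SxE !inE eqxx orbT.
      by rewrite SSx SxE !inE eqxx in xS.
    have SSy : S = Sy.
      by apply: (trivIset_eq tQ SQ SyQ inS); rewrite SyE !inE eqxx orbT.
    by rewrite SSy SyE !inE eqxx in yS.
  have [pQ2 cQ2] := pairing_add pQ1 zw tzw out2.
  exists ([set z; w] |: ([set x; y] |: Qo)).
  have [k1 k2] := keep _ (finset.subsetUr [set [set z; w]] ([set x; y] |: Qo)).
  split => //; rewrite cQ2 cQ1; apply: leq_trans cQ _.
  rewrite -addn2 leq_add2l; have c2 : #|[set Sx; Sy]| <= 2 by rewrite cards2; case: (_ != _).
  apply: leq_trans (subset_leq_card _) c2.
  by apply/fintype.subsetP => S; rewrite !inE => /andP[].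
exists ([set x; y] |: Qo); have [k1 k2] := keep _ (fintype.subxx _).
split => //; rewrite cQ1; apply: leq_trans cQ _; rewrite -addn1 leq_add2l.
(* In this case at most one pair of Q meets {x, y}, and {x, y} replaces it. *)
have [U sU] : exists U, [set S in Q | (S == Sx) || (S == Sy)] \subset [set U].
  case: (boolP (Sx \in Q)) SS => SxQ /= SS; last first.
    exists Sy; apply/fintype.subsetP => S; rewrite !inE => /andP[SQ].
    by case: eqP => // e; rewrite -e SQ in SxQ.
  exists Sx; apply/fintype.subsetP => S; rewrite !inE => /andP[SQ].
  case: (S =P Sx) => //= SSx /eqP SSy; rewrite -SSy SQ /= negbK in SS.
  by case: SSx; rewrite (eqP SS).
by rewrite -(cards1 U); exact: subset_leq_card.
Qed.

(** Exchanges insert the pairs of P one by one; pairs of P already present are disjoint from the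
    inserted one, so they survive. *)
Lemma pairing_extend (P Q : {set {set 'I_p}}) : pairing P -> pairing Q ->
  exists Q', [/\ pairing Q', P \subset Q' & #|Q| <= #|Q'|].
Proof.
move=> pP; have /pairingP[tP hP] := pP.
have [n] := ubnP #|P :\: Q|; elim: n Q => // n IH Q Qn pQ.
have [sub|/subsetPn[S SP SQ]] := boolP (P \subset Q); first by exists Q.
have [x [y [xy tw SE]]] := hP S SP.
rewrite SE in SQ; have [Q1 [pQ1 cQ1 SQ1 keep]] := pairing_exchange pQ xy tw SQ.
have [|Q2 [pQ2 s2 c2]] := IH Q1 _ pQ1.
  apply: leq_trans (_ : #|P :\: Q| <= n); last by rewrite -ltnS.
  apply: proper_card; apply/properP; split.
    apply/fintype.subsetP => U; rewrite !inE => /andP[UQ1 UP]; rewrite UP andbT.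
    have notin a : a \in S -> a \notin U.
      move=> aS; apply/negP => aU; case/negP: UQ1.
      by rewrite (trivIset_eq tP UP SP aU aS) SE.
    apply: contra UQ1 => UQ.
    by apply: keep => //; apply: notin; rewrite SE !inE eqxx ?orbT.
  exists S; first by rewrite !inE SP SE SQ.
  by rewrite !inE SE SQ1.
by exists Q2; split => //; exact: leq_trans cQ1 c2.
Qed.

End Twins.

(** * The exponent inequality *)

Section KeyInequality.
Context (d p : nat) (g : 'I_p -> gidx d).
Local Notation label := ('I_p * bool)%type.
Local Open Scope set_scope.
Local Open Scope nat_scope.
Implicit Types (S : {set 'I_p}) (P Q : {set {set 'I_p}}).
Local Notation pcol := (plain_column g).
Local Notation ccol := (conj_column g).
Local Notation locally_perfect := (locally_perfect g).

Definition column_balanced : Prop :=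
  forall c, #|[set h in [set: label] | pcol h == c]| =
            #|[set h in [set: label] | ccol h == c]|.

Lemma pairing_locally_perfect P S : pairing g P -> S \in P ->
  locally_perfect S /\ #|S| = 2.
Proof.
move=> /pairingP[_ hP] /hP[i [i' [ii' tw ->]]].
by split; [exact: twin_locally_perfect | rewrite cards2 ii'].
Qed.

Lemma p2_star_ge (j0 : 'I_d) P : column_balanced -> pairing g P ->
  #|P| <= p2_star g.
Proof.
move=> bal pP; have /pairingP[tP _] := pP.
have [C cov sm] := smart_family j0 bal tP (fun S SP => (pairing_locally_perfect pP SP).1).
apply: (bigop.bigmax_sup [ffun => j0]) => //.
apply: (bigop.bigmax_sup C cov).
apply: (bigop.bigmax_sup P) => //; rewrite tP; apply/forall_inP => S SP.
by have := sm S SP; rewrite (pairing_locally_perfect pP SP).2.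
Qed.

(** It suffices to test pairings that contain P, because [pairing_extend] enlarges some of them to
    the size of any smart family. *)
Lemma p2_star_le P n : pairing g P ->
  (forall Q, pairing g Q -> P \subset Q -> #|Q| <= n) -> p2_star g <= n.
Proof.
move=> pP maxn; apply/bigmax_leqP => J _; apply/bigmax_leqP => C cov.
apply/bigmax_leqP => A /andP[tA /forall_inP sA].
have pA : pairing g A.
  by apply/pairingP; split => // S /sA; exact: smart_pair_twin.
have [Q [pQ PQ AQ]] := pairing_extend pP pA.
exact: leq_trans AQ (maxn Q pQ PQ).
Qed.

Lemma p3_star_ge (j0 : 'I_d) P Q : column_balanced -> pairing g P ->
  #|P| = p2_star g -> finset.trivIset (P :|: Q) ->
  (forall S, S \in Q -> locally_perfect S /\ #|S| = 3) -> #|Q| <= p3_star g.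
Proof.
move=> bal pP cP tPQ hQ.
have lp S : S \in P :|: Q -> locally_perfect S.
  by case/setUP => [/(pairing_locally_perfect pP)[]|/hQ[]].
have [C cov sm] := smart_family j0 bal tPQ lp.
apply: (bigop.bigmax_sup [ffun => j0]) => //.
apply: (bigop.bigmax_sup C cov).
apply: (bigop.bigmax_sup (P, Q)) => //=; rewrite tPQ cP eqxx /=; apply/andP; split.
  apply/forall_inP => S SP; have := sm S.
  by rewrite (pairing_locally_perfect pP SP).2; apply; rewrite inE SP.
apply/forall_inP => S SQ; have := sm S.
by rewrite (hQ S SQ).2; apply; rewrite inE SQ orbT.
Qed.

(* Completing [P] to a maximum family of pairs costs at most two triplets of [Q]
   for each new pair, one for each of its elements. *)
Lemma star_tradeoff (j0 : 'I_d) P Q : column_balanced -> pairing g P ->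
  finset.trivIset (P :|: Q) ->
  (forall S, S \in Q -> locally_perfect S /\ #|S| = 3) ->
  2 * #|P| + #|Q| <= 2 * p2_star g + p3_star g.
Proof.
move=> bal pP tPQ hQ.
have PP : pairing g P && (P \subset P) by rewrite pP fintype.subxx.
case: (@arg_maxnP _ P (fun P' => pairing g P' && (P \subset P')) (fun P' => #|P'|) PP).
move=> P' /andP[pP' PP'] maxP'.
have cP' : #|P'| = p2_star g.
  apply/eqP; rewrite eqn_leq (p2_star_ge j0 bal pP') /=.
  by apply: (p2_star_le pP) => P1 pP1 sP1; apply: maxP'; rewrite pP1 sP1.
have /pairingP[tP' _] := pP'.
(* The terms used by the added pairs; the triplets kept are those avoiding them. *)
pose K := finset.cover (P' :\: P).
pose Q' := [set S in Q | S :&: K == finset.set0].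
have tQ' : finset.trivIset (P' :|: Q').
  have cross (U V : {set 'I_p}) x : U \in P' -> V \in Q' -> x \in U -> x \in V -> False.
    rewrite inE => UP /andP[VQ /eqP VK] xU xV.
    case: (boolP (U \in P)) => UP0.
      have UV : U = V.
        by apply: (trivIset_eq tPQ _ _ xU xV); rewrite inE ?UP0 ?VQ ?orbT.
      have := (hQ V VQ).2; rewrite -UV (pairing_locally_perfect pP UP0).2 //.
    have : x \in V :&: K.
      by rewrite inE xV; apply/finset.bigcupP; exists U => //; rewrite inE UP UP0.
    by rewrite VK inE.
  apply/finset.trivIsetP => A B AF BF; apply: contraNT.
  move=> /pred0Pn[x /andP[/= xA xB]]; apply/eqP.
  case/setUP: AF => AF; case/setUP: BF => BF.
  - exact: (trivIset_eq tP' AF BF xA xB).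
  - by case: (cross A B x).
  - by case: (cross B A x).
  - move: AF BF; rewrite !inE => /andP[AQ _] /andP[BQ _].
    by apply: (trivIset_eq tPQ _ _ xA xB); rewrite inE ?AQ ?BQ orbT.
have hQ' S : S \in Q' -> locally_perfect S /\ #|S| = 3.
  by rewrite inE => /andP[/hQ].
have cQ' := p3_star_ge j0 bal pP' cP' tQ' hQ'.
have cK : #|K| <= 2 * (#|P'| - #|P|).
  apply: leq_trans (leq_card_cover _) _.
  rewrite (eq_bigr (fun=> 2)) => [|S]; last first.
    by rewrite inE => /andP[_ SP]; exact: (pairing_locally_perfect pP' SP).2.
  by rewrite sum_nat_const cardsDS // mulnC.
have cD : #|Q :\: Q'| <= #|K|.
  (* Each destroyed triplet is charged to one term of K, and disjointness makes the charging
     injective. *)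
  pose f S := [pick x in S :&: K].
  have fP S : S \in Q :\: Q' -> exists2 x, f S = Some x & x \in S :&: K.
    rewrite !inE negb_and => /andP[+ SQ]; rewrite SQ /= => /set0Pn[x xS].
    by rewrite /f; case: pickP => [y yS|/(_ x)]; [exists y | rewrite xS].
  have finj : {in Q :\: Q' &, injective f}.
    move=> S S' SQ S'Q; have [x -> ] := fP S SQ; have [x' -> ] := fP S' S'Q.
    move=> + + [xx']; rewrite -xx' => /setIP[xS' _] /setIP[xS _].
    move: SQ S'Q; rewrite !inE => /andP[_ SQ] /andP[_ S'Q].
    by apply: (trivIset_eq tPQ _ _ xS xS'); rewrite inE ?SQ ?S'Q orbT.
  have someI : injective (@Some 'I_p) by move=> ? ? [].
  rewrite -(card_in_imset finj) -(card_imset K someI).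
  apply: subset_leq_card; apply/fintype.subsetP => _ /imsetP[S SQ ->].
  by have [x -> /setIP[_ xK]] := fP S SQ; exact: imset_f.
have cQ : #|Q| = #|Q'| + #|Q :\: Q'|.
  rewrite -(cardsID Q' Q); congr (_ + _); apply: eq_card => S.
  by rewrite !inE; case: (S \in Q).
have cPP := subset_leq_card PP'.
lia.
Qed.

Definition label_seq (s : seq 'I_p) : seq label :=
  flatten [seq [:: (i, false); (i, true)] | i <- s].

Lemma plain_edgesE s :
  plain_edges g s = [seq (h.1, pcol h) | h <- label_seq s].
Proof. by elim: s => //= i s <-. Qed.

Lemma label_seq_perm : perm_eq (label_seq (enum 'I_p)) (enum {: label}).
Proof.
have mem s h : (h \in label_seq s) = (h.1 \in s).
  elim: s => //= i s IH; rewrite !inE IH; case: h {IH} => [j b] /=.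
  by rewrite !xpair_eqE; case: (j == i) => //=; case: b.
apply: uniq_perm => [||h]; rewrite ?enum_uniq //; last first.
  by rewrite mem mem_enum mem_enum.
elim: (enum 'I_p) (enum_uniq 'I_p) => //= i s IH /andP[iS us].
by rewrite !inE !mem /= (negPf iS) IH // xpair_eqE andbF.
Qed.

Lemma balanced_columns (J : 'I_p -> 'I_d) :
  balanced ccol (plain_edges g (enum 'I_p)) finset.setT -> column_balanced.
Proof.
move=> /forallP bal c; have /eqP := bal c; rewrite plain_edgesE count_map => <-.
have /permP -> := label_seq_perm.
rewrite cardE -size_filter; apply/perm_size/uniq_perm => [||h].
- exact: enum_uniq.
- exact/filter_uniq/enum_uniq.
- by rewrite mem_enum mem_filter mem_enum !inE andbT.
Qed.

Lemma size_plain_edges : size (plain_edges g (enum 'I_p)) = 2 * p.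
Proof.
rewrite plain_edgesE size_map (perm_size label_seq_perm) -cardE card_prod.
by rewrite card_ord card_bool mulnC.
Qed.

(** In quarter powers of d: 4 b counts the choices of [J] with b values, a choice has exponent 12 p
    - 2 x, and the target is 7 p - 2 p2 - p3; the difference 12 p - 7 p gives 5 p. *)
Lemma key_inequality (J : {ffun 'I_p -> 'I_d}) : (0 < d) ->
  balanced ccol (plain_edges g (enum 'I_p)) finset.setT ->
  4 * #|J @: 'I_p| +
    2 * matching_number ccol J (plain_edges g (enum 'I_p)) finset.setT <=
  5 * p + 2 * p2_star g + p3_star g.
Proof.
move=> d0 /(balanced_columns J) bal.
have us : uniq (label_seq (enum 'I_p)).
  by rewrite (perm_uniq label_seq_perm) enum_uniq.
have [M [mM _ xM]] := matching_number_attained g J finset.setT us.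
rewrite -plain_edgesE => cM.
pose cls j := [set i | J i == j]; pose Mj j := [set x in M | J x.1.1 == j].
pose q j := #|cls j|; pose m j := #|Mj j|.
have mMj j : matching pcol ccol (Mj j).
  by apply: matching_sub mM; apply/fintype.subsetP => x; rewrite inE => /andP[].
have bMj j : between (labels (cls j)) (labels (cls j)) (Mj j).
  move=> x; rewrite !inE => /andP[xMM /eqP <-].
  by have [_ ->] := xM x xMM; rewrite !eqxx.
have mq j : m j <= 2 * q j.
  by rewrite /q -card_labels; exact: card_matching_le (mMj j) (bMj j).
have m1 j : q j <= 1 -> m j = 0.
  move=> q1; apply/eqP; rewrite cards_eq0; apply/eqP/setP => x.
  rewrite [RHS]inE; apply/negP => xj; have [] := bMj j x xj; rewrite !inE => a b.
  have [xx _] : x.1.1 != x.2.1 /\ J x.1.1 = J x.2.1.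
    by apply: xM; move: xj; rewrite inE => /andP[].
  case/negP: xx; apply/eqP; move/card_le1_eqP: q1; apply; by rewrite inE.
have lp j : m j = 2 * q j -> locally_perfect (cls j).
  move=> mj; exists (Mj j); split => // x; rewrite inE => /andP[+ _].
  by move=> /xM[].
pose g2 := [set j | (q j == 2) && (m j == 4)].
pose g3 := [set j | (q j == 3) && (m j == 6)].
have clsinj (j j' : 'I_d) i : i \in cls j -> i \in cls j' -> j = j'.
  by rewrite !inE => /eqP <- /eqP.
have sumq : \sum_j q j = p.
  rewrite -[RHS]card_ord -sum1_card (partition_big J predT) //=.
  by apply: eq_bigr => j _; rewrite sum1dep_card.
have summ : \sum_j m j = #|M|.
  rewrite -sum1_card (partition_big (fun x => J x.1.1) predT) //=.
  by apply: eq_bigr => j _; rewrite sum1dep_card.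
have sumim : \sum_j (j \in J @: 'I_p) = #|J @: 'I_p|.
  by rewrite -sum1_card [RHS]big_mkcond; apply: eq_bigr => j _; case: ifP.
have sumg (A : {set 'I_d}) : \sum_j (j \in A) = #|A|.
  by rewrite -sum1_card [RHS]big_mkcond; apply: eq_bigr => j _; case: ifP.
(* For a nonempty class m <= 2 q gives 4 + 2 m <= 4 + 4 q, within 5 q once q >= 4. For q = 1, m = 0.
   For q = 2 only m = 4 fails, by 2, and for q = 3 only m = 6, by 1; hence the two corrections. *)
have local j : 4 * (j \in J @: 'I_p) + 2 * m j <=
    5 * q j + 2 * (j \in g2) + (j \in g3).
  rewrite !inE; have := mq j; have := m1 j.
  have : q j = 0 -> (j \in J @: 'I_p) = false.
    move=> /eqP; rewrite cards_eq0 => /eqP q0; apply/negP => /imsetP[i _ ji].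
    by have /setP/(_ i) := q0; rewrite !inE ji eqxx.
  case: (j \in J @: 'I_p) => [/(_ _)|_]; move: (q j) (m j) => a b.
    by move=> h1 h2 h3; have [/h1|] := posnP a; lia.
  lia.
have total : 4 * #|J @: 'I_p| + 2 * #|M| <= 5 * p + 2 * #|g2| + #|g3|.
  have -> : 5 * p = 5 * \sum_j q j by rewrite sumq.
  rewrite -sumim -summ -!sumg !big_distrr /= -!big_split.
  by apply: leq_sum => j _; exact: local.
rewrite -cM; apply: leq_trans total _.
(* The exceptional classes are disjoint twin pairs and locally perfect triplets, to which
   [star_tradeoff] applies. *)
suff : 2 * #|g2| + #|g3| <= 2 * p2_star g + p3_star g by lia.
have clsI A : (forall j, j \in A -> 0 < q j) -> {in A &, injective cls}.
  move=> A0 j j' /A0 /card_gt0P[i ij] _ jj'.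
  by apply: (clsinj _ _ i); rewrite // -jj'.
have cI2 : #|cls @: g2| = #|g2|.
  by apply/card_in_imset/clsI => j; rewrite inE => /andP[/eqP ->].
have cI3 : #|cls @: g3| = #|g3|.
  by apply/card_in_imset/clsI => j; rewrite inE => /andP[/eqP ->].
rewrite -cI2 -cI3.
have tcls (A : {set 'I_d}) : finset.trivIset (cls @: A).
  apply/finset.trivIsetP => _ _ /imsetP[j _ ->] /imsetP[j' _ ->].
  apply: contraNT => /pred0Pn[i /andP[/= ij ij']].
  by rewrite (clsinj _ _ _ ij ij').
apply: (star_tradeoff (Ordinal d0)) => //.
- apply/pairingP; split => // _ /imsetP[j + ->]; rewrite inE.
  move=> /andP[/eqP qj /eqP mj]; have /eqP/cards2P[i [i' [ii' SE]]] := qj.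
  exists i, i'; split => //; apply: locally_perfect_twin => //.
  by rewrite -SE; apply: lp; rewrite mj qj.
- by rewrite -imsetU.
- move=> _ /imsetP[j + ->]; rewrite inE => /andP[/eqP qj /eqP mj].
  by split => //; apply: lp; rewrite mj qj.
Qed.

End KeyInequality.

(** * Conclusion *)

Section IndexSums.
Context (p d : nat).
Local Open Scope set_scope.
Implicit Types (J : {ffun 'I_p -> 'I_d}) (rho : {ffun 'I_p -> 'I_p}).

(** Encodes the partition of the terms by equal j-index as a map from ['I_p] to itself, so that the
    number of codes does not depend on d. *)
Definition representative J : {ffun 'I_p -> 'I_p} :=
  [ffun i => odflt i [pick i' | J i' == J i]].

Lemma representativeP J i : J (representative J i) = J i.
Proof. by rewrite ffunE; case: pickP => [i' /eqP|]. Qed.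

Lemma representative_eq J i i' : J i = J i' ->
  representative J i = representative J i'.
Proof.
move=> Jii'; rewrite !ffunE Jii'; case: pickP => //= /(_ i').
by rewrite eqxx.
Qed.

Lemma card_image_representative J :
  #|representative J @: 'I_p| = #|J @: 'I_p|.
Proof.
have inj : {in representative J @: 'I_p &, injective J}.
  move=> _ _ /imsetP[i _ ->] /imsetP[i' _ ->]; rewrite !representativeP.
  exact: representative_eq.
rewrite -(card_in_imset inj) -imset_comp; congr #|pred_of_set _|.
by apply: eq_imset => i /=; rewrite representativeP.
Qed.

Lemma card_representative_fiber rho :
  (#|[pred J | representative J == rho]| <= d ^ #|rho @: 'I_p|)%N.
Proof.
pose I := {i : 'I_p | i \in rho @: 'I_p}.
have -> : (d ^ #|rho @: 'I_p|)%N = #|{: {ffun I -> 'I_d}}|.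
  by rewrite card_ffun card_ord card_sig.
pose f J : {ffun I -> 'I_d} := [ffun x => J (val x)].
have inj : {in [pred J | representative J == rho] &, injective f}.
  move=> J J'; rewrite !inE => /eqP Jr /eqP Jr' /ffunP JJ'; apply/ffunP => i.
  rewrite -(representativeP J i) -(representativeP J' i) Jr Jr'.
  have ri : rho i \in rho @: 'I_p by exact: imset_f.
  by have := JJ' (exist _ (rho i) ri); rewrite !ffunE.
by rewrite -(card_in_image inj); exact: max_card.
Qed.

(** A partition into b classes admits at most d^b index choices, each weighted d^(-b), so every code
    contributes at most 1. *)
Lemma sum_inverse_image_le (F : numFieldType) : (0 < d)%N ->
  \sum_(J : {ffun 'I_p -> 'I_d}) (d%:R ^+ #|J @: 'I_p|)^-1 <= (p ^ p)%:R :> F.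
Proof.
move=> d0; have dR : 0 < d%:R :> F by rewrite ltr0n.
rewrite (partition_big representative predT) //=.
apply: (@le_trans _ _ (\sum_(rho : {ffun 'I_p -> 'I_p}) 1)); last first.
  by rewrite sumr_const card_ffun !card_ord.
apply: ler_sum => rho _.
rewrite (eq_bigr (fun=> (d%:R ^+ #|rho @: 'I_p|)^-1)) => [|J /eqP <-]; last first.
  by rewrite card_image_representative.
rewrite sumr_const -[leLHS]mulr_natl ler_pdivrMr ?exprn_gt0 // mul1r -natrX.
by rewrite ler_nat; exact: card_representative_fiber.
Qed.

End IndexSums.

(** Truncation at 12 p is harmless: a balanced exponent is at most 6 (2 p), and in the unbalanced
    case 4 b + 7 p <= 11 p. *)
Lemma exponent_lower_bound (d p : nat) (g : 'I_p -> gidx d)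
    (J : {ffun 'I_p -> 'I_d}) : (0 < d)%N ->
  (4 * #|(J @: 'I_p)%SET| + 7 * p <=
   exponent (conj_column g) J (12 * p) (plain_edges g (enum 'I_p)) finset.setT
   + 2 * p2_star g + p3_star g)%N.
Proof.
move=> d0.
have im : (#|(J @: 'I_p)%SET| <= p)%N.
  by apply: leq_trans (leq_imset_card _ _) _; rewrite card_ord.
rewrite /exponent size_plain_edges; case: ifP => [/(key_inequality J d0)|_]; last by lia.
have := matching_number_size (conj_column g) J (plain_edges g (enum 'I_p)) finset.setT.
rewrite size_plain_edges; move: (p2_star g) (p3_star g); lia.
Qed.

Lemma quarter_power (R : realType) (d n : nat) : (0 < d)%N ->
  (d%:R `^ (- 4^-1) : R) ^+ n = d%:R `^ (- (n%:R / 4)).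
Proof.
move=> d0; rewrite -powR_mulrn ?powR_ge0 // -powRrM; congr (_ `^ _).
by rewrite mulNr mulrC.
Qed.

Theorem theorem3p11 (R : realType) (p : nat) :
  exists2 K : R, 0 < K &
    \forall d \near \oo,
      forall (disp : measure_display) (T : measurableType disp)
             (P : probability T R) (Psi : T -> 'M[R[i]]_d),
        haar_unitary P Psi ->
        forall g : 'I_p -> gidx d,
          let p2 := (p2_star g)%:R : R in
          let p3 := (p3_star g)%:R : R in
          `| cexpectation P (fun w => \prod_(i < p) gamma (Psi w) (g i)) |
          <= (K * d%:R `^ (- (3 / 2) * p%:R - 6^-1 * (3 * p3)
                           - 4^-1 * (p%:R - 2 * p2 - 3 * p3)))%:C.
Proof.
pose K : nat := (moment_constant (2 * p) (12 * p) * p ^ p)%N.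
exists K%:R.
  rewrite ltr0n !muln_gt0 !expn_gt0 !muln_gt0 /=.
  (* For p = 0 the factor [p ^ p] is 1. *)
  by case: (p).
exists 1%N => // d /= d0 disp T P Psi hPsi g.
set p2 : R := (p2_star g)%:R; set p3 : R := (p3_star g)%:R.
(* Collecting terms, the target is -(7 p - 2 p2 - p3) / 4, which is why integral powers of u =
   d^(-1/4) are used. *)
set target := _ - _ - _.
have dR1 : 1 <= d%:R :> R by rewrite ler1n.
pose u : R := d%:R `^ (- 4^-1).
have u0 : 0 <= u by exact: powR_ge0.
have u1 : u <= 1 by rewrite -(powRr0 d%:R) ler_powR // oppr_le0 invr_ge0.
have u4 : u ^+ 4 = d%:R^-1.
  by rewrite quarter_power // divff ?pnatr_eq0 // powR_inv1 // ler0n.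
have -> : cexpectation P (fun w => \prod_(i < p) gamma (Psi w) (g i)) =
    \sum_(J : {ffun 'I_p -> 'I_d}) cexpectation P (fun w =>
      wick (conj_column g) J (plain_edges g (enum 'I_p)) finset.setT (Psi w)).
  rewrite -(Epoly_sum hPsi _ _ (fun J : {ffun 'I_p -> 'I_d} =>
    wick_poly R (conj_column g) J (plain_edges g (enum 'I_p)) finset.setT)).
  exact: (Epoly_eq hPsi (fun psi upsi => prod_gamma g d0 upsi)).
(* The spare factor d^(-b), with b the number of values of [J], pays for the sum over [J]. *)
have bound (J : {ffun 'I_p -> 'I_d}) : `|cexpectation P (fun w =>
      wick (conj_column g) J (plain_edges g (enum 'I_p)) finset.setT (Psi w))| <=
    (moment_constant (2 * p) (12 * p))%:R * (d%:R `^ target)%:C *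
      (d%:R ^+ #|(J @: 'I_p)%SET|)^-1.
  have cT : #|[set: ('I_p * bool)%type]%SET| = (2 * p)%N.
    by rewrite cardsT card_prod card_ord card_bool mulnC.
  have uC0 : 0 <= u%:C :> R[i] by rewrite ler0c.
  have uC1 : u%:C <= 1 :> R[i] by rewrite -[1]/(1%:C) lecR.
  have uC4 : u%:C ^+ 4 = d%:R^-1 :> R[i] by rewrite -rmorphXn u4 fmorphV rmorph_nat.
  have := moment_bound hPsi d0 (conj_column g) J uC0 uC1 uC4 (N := (2 * p)%N) (12 * p)
    (A := plain_edges g (enum 'I_p)) (B := finset.setT).
  rewrite size_plain_edges cT => /(_ (leqnn _) erefl) /le_trans; apply.
  rewrite -mulrA; apply: ler_wpM2l; first by rewrite ler0n.
  rewrite -rmorphXn -(rmorph_nat (real_complex R)) -rmorphXn -fmorphV -rmorphM lecR /=.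
  rewrite quarter_power // -powR_mulrn ?ler0n // -powRN -powRD; last first.
    by rewrite pnatr_eq0 -lt0n d0 implybT.
  apply: ler_powR => //.
  set e := exponent _ _ _ _ _; set a := #|_|.
  have : 4 * a%:R + 7 * p%:R <= e%:R + 2 * p2 + p3.
    by rewrite -!natrM -!natrD ler_nat; exact: exponent_lower_bound.
  by rewrite /target; lra.
apply: le_trans (ler_norm_sum _ _ _) _.
apply: le_trans (ler_sum _ (fun J _ => bound J)) _.
rewrite -mulr_sumr.
have natC n : (n%:R : R)%:C = n%:R :> R[i] by exact: rmorph_nat.
have -> : (K%:R * d%:R `^ target)%:C = (moment_constant (2 * p) (12 * p))%:R *
    (d%:R `^ target)%:C * (p ^ p)%:R :> R[i].
  by rewrite rmorphM /= natC /K natrM mulrAC.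
apply: ler_wpM2l; last exact: sum_inverse_image_le.
by rewrite mulr_ge0 ?ler0n // ler0c powR_ge0.
Qed.
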